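(* Let $\mathcal F$ be a minor-closed family of finite graphs which does not contain every tree. Then $c_1(\mathcal F)<\infty$. Equivalently, for every minor-closed family $\mathcal F$ of finite graphs of bounded pathwidth (i.e. for which there is an integer $k$ such that every graph in $\mathcal F$ has pathwidth at most $k$), the multi-commodity max-flow/min-cut gap is uniformly bounded: $\mathsf{gap}(\mathcal F)<\infty$.
   Context: Graphs are finite, undirected, without loops or parallel edges. A family of graphs is minor-closed if it contains every minor of each of its members (graphs are considered up to isomorphism). The pathwidth of a graph $G$ is the minimum width of a path decomposition of $G$, i.e. of a tree decomposition whose underlying tree is a path; the width is the maximum bag size minus one. For a graph $G=(V,E)$ and a length function $\mathrm{len}:E\to[0,\infty)$, $d_{\mathrm{len}}$ denotes the induced shortest-path pseudometric on $V$. A pseudometric $d$ on $V$ is supported on $G$ if $d=d_{\mathrm{len}}$ for some such $\mathrm{len}$; only finite-valued $d$ are considered here. For a finite (pseudo)metric space $(X,d)$, $c_1(X,d)$ is the infimum of all $D$ such that there is a map $f:X\to L_1([0,1])$ with $d(x,y)\le \|f(x)-f(y)\|_1\le D\,d(x,y)$ for all $x,y\in X$. Put $c_1(G)=\sup_d c_1(V,d)$, where $d$ ranges over all (pseudo)metrics supported on $G$ (with $c_1(G)=1$ if there are none), and $c_1(\mathcal F)=\sup_{G\in\mathcal F}c_1(G)$. A multi-commodity flow instance in $G$ is a pair of non-negative mappings $\mathrm{cap}:E\to\mathbb R$ and $\mathrm{dem}:V\times V\to\mathbb R$. $\mathsf{maxflow}(G;\mathrm{cap},\mathrm{dem})$ is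 the maximal $\varepsilon$ such that a flow of value $\varepsilon\cdot\mathrm{dem}(u,v)$ can be simultaneously routed between every pair $u,v\in V$ without violating the edge capacities $\mathrm{cap}$ (the total flow through an edge, summed over all pairs, is at most its capacity). For $S\subseteq V$ let $$\Phi(S;\mathrm{cap},\mathrm{dem})=\frac{\sum_{uv\in E}\mathrm{cap}(u,v)|\mathbf 1_S(u)-\mathbf 1_S(v)|}{\sum_{u,v\in V}\mathrm{dem}(u,v)|\mathbf 1_S(u)-\mathbf 1_S(v)|},$$ where $\mathbf 1_S$ is the indicator function of $S$. Then $$\mathsf{gap}(G)=\sup_{\mathrm{cap},\mathrm{dem}}\frac{\min_{S\subseteq V}\Phi(S;\mathrm{cap},\mathrm{dem})}{\mathsf{maxflow}(G;\mathrm{cap},\mathrm{dem})},$$ where the minimum is over $S$ with non-zero denominator and the supremum is over instances with $0<\mathsf{maxflow}<\infty$ (with $\mathsf{gap}(G)=1$ if there are none). Finally $\mathsf{gap}(\mathcal F)=\sup_{G\in\mathcal F}\mathsf{gap}(G)$. *)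

(* Defs.v *)
From mathcomp Require Import all_boot all_order all_algebra.
From mathcomp Require Import all_classical all_reals all_analysis.

Set Implicit Arguments.
Unset Strict Implicit.
Unset Printing Implicit Defensive.
Import Order.TTheory GRing.Theory Num.Theory.
Local Open Scope ring_scope.

Record sgraph := SGraph {
  vertex :> finType;
  adj : rel vertex;
  adj_sym : symmetric adj;
  adj_irrefl : irreflexive adj }.

Arguments adj {s}.

Definition connected_in (G : sgraph) (A : {set G}) : Prop :=
  {in A &, forall x y, connect [rel a b | [&& a \in A, b \in A & adj a b]] x y}.

(* [H] is, up to isomorphism, a minor of [G]: the vertices of [H] are obtained
   by contracting the disjoint connected sets [B x] of [G], and the vertices of
   [G] outside these sets and the superfluous edges are deleted. *)
Definition minor (H G : sgraph) : Prop :=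
  exists B : H -> {set G},
    [/\ forall x, B x != finset.set0,
        forall x, connected_in (B x),
        forall x y, x != y -> [disjoint B x & B y] &
        forall x y, adj x y -> exists a b, [/\ a \in B x, b \in B y & adj a b]].

Definition minor_closed (F : sgraph -> Prop) : Prop :=
  forall G H : sgraph, F G -> minor H G -> F H.

Definition is_tree (G : sgraph) : Prop :=
  [/\ (0 < #|G|)%N,
      forall x y : G, connect adj x y &
      forall c : seq G, uniq c -> cycle adj c -> (size c < 3)%N].

(* The underlying path has vertices 0, 1, ..., n in this order. *)
Definition path_decomposition (G : sgraph) (n : nat)
    (X : 'I_n.+1 -> {set G}) : Prop :=
  [/\ forall v, exists i, v \in X i,
      forall u v, adj u v -> exists i, (u \in X i) && (v \in X i) &
      forall i j k : 'I_n.+1, (i <= j <= k)%N -> (X i :&: X k)%SET \subset X j].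

(* Truncated subtraction: the width is 0, not -1, if all bags are empty, which
   only happens for the graph without vertices. *)
Definition width (G : sgraph) (n : nat) (X : 'I_n.+1 -> {set G}) : nat :=
  (\max_i #|X i|).-1.

Definition has_width (G : sgraph) (w : nat) : Prop :=
  exists n (X : 'I_n.+1 -> {set G}), path_decomposition X /\ width X = w.

Lemma has_width_ex (G : sgraph) : exists w, `[< has_width G w >].
Proof.
exists (width (fun _ : 'I_1 => [set: G]%SET)); apply/asboolP.
exists 0%N, (fun _ : 'I_1 => [set: G]%SET); split=> //; split.
- by move=> v; exists ord0; rewrite inE.
- by move=> u v _; exists ord0; rewrite !inE.
- by move=> i j k _; apply/fintype.subsetP => x _; rewrite inE.
Qed.

Definition pathwidth (G : sgraph) : nat := ex_minn (has_width_ex G).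

Section Metric.
Variable R : realType.

(* Functions on the edges of [G] are represented by functions on all vertex
   sets, of which only the values at [set u; v] with [adj u v] matter. *)
Definition edge_nonneg (G : sgraph) (w : {set G} -> R) : Prop :=
  forall u v, adj u v -> 0 <= w [set u; v]%SET.

Definition walk_length (G : sgraph) (len : {set G} -> R) (u : G) (p : seq G) : R :=
  \sum_(e <- pairmap (fun x y => [set x; y]%SET) u p) len e.

(* Equal to +oo if [u] and [v] are in different components. *)
Definition sp_dist (G : sgraph) (len : {set G} -> R) (u v : G) : \bar R :=
  ereal_inf [set (walk_length len u p)%:E | p in
    [set p : seq G | path adj u p /\ last u p = v]]%classic.

Definition supported_on (G : sgraph) (d : G -> G -> R) : Prop :=
  exists2 len : {set G} -> R, edge_nonneg len &
    forall u v, (d u v)%:E = sp_dist len u v.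

Definition L1_dist (f g : R -> R) : \bar R :=
  (\int[lebesgue_measure]_(t in `[0%R, 1%R]%classic) `|(f t - g t)%:E|)%E.

(* Elements of L_1([0,1]) are given by representatives. *)
Definition embeds_L1 (T : finType) (d : T -> T -> R) (D : R) : Prop :=
  exists2 f : T -> R -> R,
    forall x, lebesgue_measure.-integrable `[0%R, 1%R]%classic (EFin \o f x) &
    forall x y,
      ((d x y)%:E <= L1_dist (f x) (f y) <= (D * d x y)%:E)%E.

(* [embeds_L1 d D] forces [1 <= D] unless [d] is identically 0; requiring it
   gives c_1 = 1 instead of -oo in that case. *)
Definition c1_metric (T : finType) (d : T -> T -> R) : \bar R :=
  ereal_inf [set D%:E | D in [set D : R | 1 <= D /\ embeds_L1 d D]]%classic.

Definition sup_or_1 (A : set (\bar R)) : \bar R :=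
  if A == set0%classic then 1%E else ereal_sup A.

Definition c1_graph (G : sgraph) : \bar R :=
  sup_or_1 [set c1_metric d | d in [set d | @supported_on G d]]%classic.

Definition c1_family (F : sgraph -> Prop) : \bar R :=
  ereal_sup [set x | exists2 G, F G & x = c1_graph G]%classic.

(* [f s t a b] is the amount of the commodity with source [s] and sink [t] sent
   along the edge [ab] from [a] to [b]. *)
Definition routable (G : sgraph) (cap : {set G} -> R) (dem : G -> G -> R)
    (eps : R) : Prop :=
  exists f : G -> G -> G -> G -> R,
    [/\ forall s t a b, 0 <= f s t a b,
        forall s t a b, ~~ adj a b -> f s t a b = 0,
        forall s t a, \sum_b f s t a b - \sum_b f s t b a =
          eps * dem s t * ((a == s)%:R - (a == t)%:R) &
        forall a b, adj a b ->
          \sum_s \sum_t (f s t a b + f s t b a) <= cap [set a; b]%SET].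

Definition maxflow (G : sgraph) (cap : {set G} -> R) (dem : G -> G -> R) : \bar R :=
  ereal_sup [set eps%:E | eps in [set eps : R | 0 <= eps /\ routable cap dem eps]]%classic.

Definition cut_dist (G : sgraph) (S : {set G}) (u v : G) : R :=
  `|(u \in S)%:R - (v \in S)%:R|.

(* Every edge occurs twice in the double sum. *)
Definition cut_cap (G : sgraph) (cap : {set G} -> R) (S : {set G}) : R :=
  2^-1 * \sum_(u : G) \sum_(v : G | adj u v) cap [set u; v]%SET * cut_dist S u v.

Definition cut_dem (G : sgraph) (dem : G -> G -> R) (S : {set G}) : R :=
  \sum_(u : G) \sum_(v : G) dem u v * cut_dist S u v.

Definition sparsity (G : sgraph) (cap : {set G} -> R) (dem : G -> G -> R)
    (S : {set G}) : R :=
  cut_cap cap S / cut_dem dem S.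

Definition sparsest_cut (G : sgraph) (cap : {set G} -> R) (dem : G -> G -> R) : \bar R :=
  \big[Order.min/+oo%E]_(S : {set G} | cut_dem dem S != 0) (sparsity cap dem S)%:E.

Definition flow_instance (G : sgraph) (cap : {set G} -> R) (dem : G -> G -> R) : Prop :=
  [/\ edge_nonneg cap, forall u v, 0 <= dem u v &
      (0 < maxflow cap dem < +oo)%E].

Definition gap_graph (G : sgraph) : \bar R :=
  sup_or_1 [set x | exists (cap : {set G} -> R) (dem : G -> G -> R),
    flow_instance cap dem /\
    x = (sparsest_cut cap dem / maxflow cap dem)%E]%classic.

Definition gap_family (F : sgraph -> Prop) : \bar R :=
  ereal_sup [set x | exists2 G, F G & x = gap_graph G]%classic.

End Metric.

Arguments c1_family R F : clear implicits.
Arguments gap_family R F : clear implicits.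

(* Main.v *)
From mathcomp Require Import all_boot all_order all_algebra zify lra.
From mathcomp Require Import boolp.

(**
A graph [G] without a fixed tree as a minor has bounded pathwidth: following
Diestel, one grows a model of the tree whose branch sets are rooted in the
boundary of a vertex set [X] that is maximal among the sets with boundary that
small and with a suitable path decomposition; submodularity of the boundary
size and Menger's theorem allow the model to be extended as long as [X] is not
everything.

A graph with bags of size at most [m] is peeled in [m] rounds, each of which
removes from every component a geodesic from its first to its last bag, hence
a vertex of every nonempty bag (this is the shortest path decomposition of
Abraham, Filtser, Gupta and Neiman).  Let [X] be the set of vertices left at
some stage and [r u] the distance from [u] to the complement of [X].  Mapping
[u] to the indicator of the interval [[g u - r u, g u + r u]], where [g]
measures the position along the geodesic removed from the component of [u], is
Lipschitz on all of [G]; together with the coordinates [r] it separates [u] and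
[v] at the stage at which both get close, on the scale of their distance, to
the geodesics removed.  As all coordinates are intervals, the metric obtained
is a nonnegative combination of cut metrics.

For the flow-cut gap, linear programming duality (Farkas) turns a demand that
cannot be routed into edge lengths, and the corresponding cut metric contains
a sparse cut.
*)

Set Implicit Arguments.
Unset Strict Implicit.
Unset Printing Implicit Defensive.

(** * Excluding a tree *)

Section Boundary.
Variable T : finType.
Implicit Types (e : rel T) (X Y Z : {set T}).

Definition boundary e X := [set x in X | [exists y, (y \notin X) && e x y]].

Lemma boundaryP e X x :
  reflect (x \in X /\ exists2 y, y \notin X & e x y) (x \in boundary e X).
Proof.
rewrite inE; apply: (iffP andP) => [[xX /existsP[y /andP[yX exy]]]|[xX [y yX exy]]].
  by split=> //; exists y.
by split=> //; apply/existsP; exists y; rewrite yX.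
Qed.

Lemma boundary0 e : boundary e set0 = set0.
Proof. by apply/setP => x; rewrite !inE. Qed.

(** A vertex in either boundary on the left lies in one of those on the right, and a vertex in both
    lies in both; the cardinalities of unions and intersections compare accordingly. *)
Lemma boundary_submod e X Y :
  #|boundary e (X :&: Y)| + #|boundary e (X :|: Y)|
    <= #|boundary e X| + #|boundary e Y|.
Proof.
rewrite -cardsUI -[in leqRHS]cardsUI leq_add //; apply/subset_leq_card/subsetP => x.
  rewrite in_setU => /orP[] /boundaryP[].
    rewrite inE => /andP[xX xY] [y]; rewrite inE negb_and => /orP[] yN exy; rewrite inE.
      by apply/orP; left; apply/boundaryP; split=> //; exists y.
    by apply/orP; right; apply/boundaryP; split=> //; exists y.
  rewrite inE => /orP[] xX [y]; rewrite inE negb_or => /andP[yX yY] exy; rewrite inE.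
    by apply/orP; left; apply/boundaryP; split=> //; exists y.
  by apply/orP; right; apply/boundaryP; split=> //; exists y.
rewrite in_setI => /andP[/boundaryP[+ _] /boundaryP[_ [y + exy]]].
rewrite !inE negb_or => /andP[xX xY] /andP[yX yY].
by rewrite xX xY /=; apply/andP; split; apply/existsP; exists y; rewrite ?yX ?yY.
Qed.

Lemma boundary_setU1 e X y : boundary e (y |: X) \subset y |: boundary e X.
Proof.
apply/subsetP => x; rewrite in_setU1 => /boundaryP[].
rewrite in_setU1 => /orP[->//|xX] -[z]; rewrite in_setU1 negb_or => /andP[_ zX] exz.
by apply/orP; right; apply/boundaryP; split=> //; exists z.
Qed.

(* [X] induces a subgraph with a path decomposition of width at most [k] whose
   last bag contains the boundary of [X]. *)
Inductive admissible e (k : nat) : {set T} -> Prop :=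
| admissible0 : admissible e k set0
| admissibleU1 X y :
    admissible e k X -> #|boundary e (y |: X)| <= k -> admissible e k (y |: X).

(** Intersect the stages [W] of the construction of [Y] with [X]. By submodularity, and since
    [X :|: W] has no smaller boundary than [X], the boundary of [X :&: W] is no larger than that of
    [W]. *)
Lemma admissible_sub e k X Y :
  admissible e k Y -> X \subset Y ->
  (forall Z, X \subset Z -> Z \subset Y -> #|boundary e X| <= #|boundary e Z|) ->
  admissible e k X.
Proof.
move=> admY sXY minX.
suff H W : admissible e k W -> W \subset Y -> admissible e k (X :&: W).
  by rewrite -(setIidPl sXY); apply: H.
elim=> [|{}W y admW IH leW]; first by rewrite setI0; constructor.
move=> sWY; have sW : W \subset Y by apply: subset_trans sWY; apply: subsetUr.
have [yX|yX] := boolP (y \in X); last first.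
  rewrite (_ : X :&: (y |: W) = X :&: W); first exact: IH.
  apply/setP=> z; rewrite !inE; have [->|//] := eqVneq z y.
  by rewrite (negbTE yX).
have eqW : X :&: (y |: W) = y |: (X :&: W).
  by apply/setP=> z; rewrite !inE; have [->|] := eqVneq z y; rewrite ?yX.
rewrite eqW; constructor; first exact: IH.
rewrite -eqW; apply: leq_trans leW.
have := boundary_submod e X (y |: W).
have := minX (X :|: (y |: W)) (subsetUl _ _); rewrite subUset sXY sWY => /(_ isT).
lia.
Qed.

Definition connected_rel e (A : {set T}) : Prop :=
  {in A &, forall x y, connect [rel a b | [&& a \in A, b \in A & e a b]] x y}.

Lemma connected_rel1 e x : connected_rel e [set x].
Proof. by move=> a b /set1P-> /set1P->; apply: connect0. Qed.

Lemma connected_rel_sub e e' A :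
  subrel e e' -> connected_rel e A -> connected_rel e' A.
Proof.
move=> ee' cA x y xA yA; apply: connect_sub (cA x y xA yA) => a b /and3P[aA bA eab].
by apply: connect1; rewrite /= aA bA ee'.
Qed.

Lemma connected_relU1 e A x y : symmetric e ->
  connected_rel e A -> x \in A -> e x y -> connected_rel e (y |: A).
Proof.
move=> syme cA xA exy.
set r := [rel a b | [&& a \in y |: A, b \in y |: A & e a b]].
have sr : connect_sym r.
  by apply: sym_connect_sym => a b /=; rewrite syme andbCA.
have toA a b : a \in A -> b \in A -> connect r a b.
  move=> aA bA; apply: connect_sub (cA a b aA bA) => c d /and3P[cA' dA' ecd].
  by apply: connect1; rewrite /= !inE cA' dA' ecd !orbT.
have xr a : a \in y |: A -> connect r x a.
  rewrite inE => /orP[/set1P->|]; last exact: toA.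
  by apply: connect1; rewrite /= !inE xA eqxx exy orbT.
by move=> a b /xr xa /xr xb; apply: connect_trans xb; rewrite sr.
Qed.

End Boundary.

(** * Linking two boundaries by disjoint connected sets *)

Section Linkage.
Variables (T I : finType) (A : {set I}).
Implicit Types (e : rel T) (X Y Z : {set T}) (f : I -> {set T}).

Definition rooted_family e X f : Prop :=
  [/\ {in A, forall i, f i \subset X},
      {in A, forall i, connected_rel e (f i)},
      {in A, forall i, exists2 x, x \in f i & x \in boundary e X} &
      {in A &, forall i j, i != j -> [disjoint f i & f j]}].

(** Disjointness makes the roots distinct, so counting shows that they exhaust the boundary. *)
Lemma rooted_family_cover e X f :
  rooted_family e X f -> #|boundary e X| = #|A| ->
  forall x, x \in boundary e X -> exists2 i, i \in A & x \in f i.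
Proof.
move=> [_ _ fb fdis] cX x xb.
have /fin_all_exists[r rP] : forall i, exists z, i \in A -> (z \in f i) && (z \in boundary e X).
  move=> i; have [/fb[z zf zb]|iA] := boolP (i \in A); first by exists z; rewrite zf zb.
  by exists x.
have rinj : {in A &, injective r}.
  move=> i j iA jA eqr; apply/eqP; apply/negPn/negP => nij.
  have /andP[ri _] := rP i iA; have /andP[rj _] := rP j jA.
  by have /disjoint_setI0/setP/(_ (r i)) := fdis i j iA jA nij; rewrite !inE ri eqr rj.
have sub : r @: A \subset boundary e X.
  by apply/subsetP => _ /imsetP[i iA ->]; have /andP[] := rP i iA.
have : r @: A == boundary e X by rewrite eqEcard sub (card_in_imset rinj) cX /=.
move=> /eqP E; move: xb; rewrite -E => /imsetP[i iA ->].
by exists i => //; have /andP[] := rP i iA.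
Qed.

(** If adding [y] loses no boundary vertex, [f] remains valid. Otherwise exactly one vertex [x] is
    lost and [y] replaces it; the set through [x] is extended along the edge to [y]. *)
Lemma rooted_family_step e X y f :
  symmetric e -> y \notin X -> rooted_family e X f ->
  #|boundary e X| = #|A| -> #|boundary e (y |: X)| = #|A| ->
  exists2 f', rooted_family e (y |: X) f' & {in A, forall i, f i \subset f' i}.
Proof.
move=> syme yX ff cX cY; have cover := rooted_family_cover ff cX.
case: (ff) => fX fc fb fdis.
have fXy i : i \in A -> f i \subset y |: X.
  by move=> /fX h; apply: subset_trans h (subsetUr _ _).
have bsub := boundary_setU1 e X y.
have [sYX|/subsetPn[x xX xY]] := boolP (boundary e X \subset boundary e (y |: X)).
  exists f; last by [].
  split=> // i iA; have [x xf xb] := fb i iA; exists x => //.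
  exact: (subsetP sYX).
have yb : y \in boundary e (y |: X).
  apply/negPn/negP => yb.
  have : boundary e (y |: X) \proper boundary e X.
    rewrite properE; apply/andP; split; last by apply/subsetPn; exists x.
    apply/subsetP => z zb; move: (subsetP bsub z zb); rewrite in_setU1 => /orP[/eqP E|//].
    by rewrite -{1}E zb in yb.
  by move=> /proper_card; rewrite cX cY ltnn.
have others z : z \in boundary e X -> z != x -> z \in boundary e (y |: X).
  move=> zX zx.
  have E : boundary e (y |: X) \subset y |: (boundary e X :\ x).
    apply/subsetP => t tb; move: (subsetP bsub t tb); rewrite !in_setU1 in_setD1.
    by have [E|_ ->] := eqVneq t x; [rewrite E (negbTE xY) in tb | ].
  have : boundary e (y |: X) == y |: (boundary e X :\ x).
    rewrite eqEcard E /= cardsU1 cY in_setD1.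
    rewrite (_ : y \in boundary e X = false) ?andbF /=; last first.
      by apply/negbTE/negP => /boundaryP[]; rewrite (negbTE yX).
    by have := cardsD1 x (boundary e X); rewrite xX cX; lia.
  by move=> /eqP->; rewrite in_setU1 in_setD1 zx zX orbT.
have exy : e x y.
  have /boundaryP[xX' [z zX exz]] := xX; have [<-//|zy] := eqVneq z y.
  case/negP: xY; apply/boundaryP; split; first by rewrite in_setU1 xX' orbT.
  by exists z => //; rewrite in_setU1 negb_or zy.
have [i0 i0A xf] := cover x xX.
exists (fun i => if i == i0 then y |: f i else f i); last first.
  by move=> i iA; case: eqP => // _; apply: subsetUr.
have yf i : i \in A -> y \notin f i.
  by move=> iA; apply: contra yX; apply: (subsetP (fX i iA)).
split.
- move=> i iA; case: eqP => _; last exact: fXy.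
  by rewrite subUset sub1set setU11 fXy.
- move=> i iA; case: eqP => [->|_]; last exact: fc.
  by apply: (connected_relU1 syme (fc i0 i0A) xf exy).
- move=> i iA; case: eqP => [_|/eqP ni]; first by exists y; rewrite ?setU11.
  have [z zf zb] := fb i iA; exists z => //; apply: others => //.
  apply: contraTneq zf => ->; apply/negP => xfi.
  by have /disjoint_setI0/setP/(_ x) := fdis i i0 iA i0A ni; rewrite !inE xfi xf.
- move=> i j iA jA nij.
  have [Ei|ni] := eqVneq i i0; have [Ej|nj] := eqVneq j i0.
  + by rewrite Ei Ej eqxx in nij.
  + by rewrite -setI_eq0 setIUl setU_eq0 !setI_eq0 disjoints1 yf // fdis.
  + by rewrite -setI_eq0 setIUr setU_eq0 !setI_eq0 disjoint_sym disjoints1 yf // fdis.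
  + exact: fdis.
Qed.

(* Menger's theorem in the form needed here.  If no set between [X] and [Y] has
   the same boundary size, an edge leaving [X] inside [Y] can be deleted. *)
Lemma rooted_family_link e X Y f :
  symmetric e -> X \subset Y -> rooted_family e X f ->
  #|boundary e X| = #|A| -> #|boundary e Y| = #|A| ->
  (forall Z, X \subset Z -> Z \subset Y -> #|A| <= #|boundary e Z|) ->
  exists2 f', rooted_family e Y f' & {in A, forall i, f i \subset f' i}.
Proof.
have [n] := ubnP (#|Y :\: X| + #|[set p | e p.1 p.2]|).
elim: n e X Y f => // n IH e X Y f le_n syme sXY ff cX cY minA.
(* An intermediate set with a boundary of minimal size splits the problem into two smaller ones. *)
have split_at Z : X \subset Z -> Z \subset Y -> X != Z -> Z != Y ->
    #|boundary e Z| = #|A| ->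
    exists2 f', rooted_family e Y f' & {in A, forall i, f i \subset f' i}.
  move=> sXZ sZY nXZ nZY cZ.
  have pXZ : Z :\: X \proper Y :\: X.
    have /properP[_ [z zY zZ]] : Z \proper Y by rewrite properEneq nZY.
    apply/properP; split; first exact: setSD.
    exists z; rewrite !inE ?zY ?(negbTE zZ) ?andbF // andbT.
    by apply: contra zZ; apply: (subsetP sXZ).
  have pZY : Y :\: Z \proper Y :\: X.
    have /properP[_ [z zZ zX]] : X \proper Z by rewrite properEneq nXZ.
    apply/properP; split; first exact: setDS.
    by exists z; rewrite !inE ?zX ?zZ ?(subsetP sZY).
  have [||f1 ff1 sf1] := IH e X Z f _ syme sXZ ff cX cZ.
    by have := proper_card pXZ; lia.
    by move=> W sXW sWZ; apply: minA => //; apply: subset_trans sZY.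
  have [||f2 ff2 sf2] := IH e Z Y f1 _ syme sZY ff1 cZ cY.
    by have := proper_card pZY; lia.
    by move=> W sZW sWY; apply: minA => //; apply: subset_trans sZW.
  by exists f2 => // i iA; apply: subset_trans (sf1 i iA) (sf2 i iA).
(* Without an edge from [X] into [Y :\: X], the roots have their outer neighbours outside [Y], so
   [f] is already rooted in the boundary of [Y]. *)
have [/existsP[[x y]]|noedge] :=
    boolP [exists p, [&& p.1 \in X, p.2 \in Y :\: X & e p.1 p.2]]; last first.
  exists f; last by [].
  case: ff => fX fc fb fdis; split=> // i iA.
    by apply: subset_trans sXY; apply: fX.
  have [x xf /boundaryP[xX [y yX exy]]] := fb i iA; exists x => //.
  apply/boundaryP; split; first exact: (subsetP sXY).
  exists y => //; apply: contra noedge => yY; apply/existsP; exists (x, y).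
  by rewrite /= xX exy !inE yX yY.
rewrite /= => /and3P[xX]; rewrite inE => /andP[yX yY] exy.
have sZ : y |: X \subset Y by rewrite subUset sub1set yY.
have [cZ|ncZ] := eqVneq #|boundary e (y |: X)| #|A|.
  have [EZ|nZ] := eqVneq (y |: X) Y.
    by rewrite -EZ; apply: rooted_family_step.
  apply: (split_at (y |: X)) => //; first exact: subsetUr.
  by apply: contraNneq yX => ->; rewrite setU11.
have [/existsP[Z /and5P[sXZ sZY nXZ nZY /eqP cZ]]|none] := boolP [exists Z : {set T},
    [&& X \subset Z, Z \subset Y, X != Z, Z != Y & #|boundary e Z| == #|A| ]].
  exact: (split_at Z).
pose e' := [rel a b | e a b && ((a, b) != (x, y)) && ((a, b) != (y, x))].
have syme' : symmetric e'.
  move=> a b /=; rewrite syme !xpair_eqE -!andbA; congr (_ && _).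
  by rewrite andbC (andbC (b == x)) (andbC (b == y)).
have se' : subrel e' e by move=> a b /=; rewrite -andbA => /andP[].
have be' Z : boundary e' Z \subset boundary e Z.
  by apply/subsetP => z /boundaryP[zZ [t tZ /se' ezt]]; apply/boundaryP; split=> //; exists t.
(* The end [x] of the deleted edge lies in [Z], so only [x] can leave the boundary. *)
have bd Z : X \subset Z -> boundary e Z \subset x |: boundary e' Z.
  move=> sXZ; apply/subsetP => z /boundaryP[zZ [t tZ ezt]].
  rewrite in_setU1; have [//|nzx] := eqVneq z x.
  apply/orP; right; apply/boundaryP; split=> //; exists t => //=.
  rewrite ezt !xpair_eqE (negbTE nzx) /= negb_and orbC.
  by apply/orP; left; apply: contraNneq tZ => ->; apply: (subsetP sXZ).
have bY : boundary e' Y = boundary e Y.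
  apply/eqP; rewrite eqEsubset be' /=; apply/subsetP => z /boundaryP[zY [t tY ezt]].
  apply/boundaryP; split=> //; exists t => //=; rewrite ezt !xpair_eqE.
  have -> : t == y = false by apply: contraNF tY => /eqP->.
  have -> : t == x = false by apply: contraNF tY => /eqP->; apply: (subsetP sXY).
  by rewrite !andbF.
(* If [x] left this boundary, [y] would be its only neighbour outside [X], and adding [y] to [X]
   would not enlarge the boundary, against [ncZ] and minimality. *)
have bX : boundary e' X = boundary e X.
  apply/eqP; rewrite eqEsubset be' /=; apply/subsetP => z zb.
  have := subsetP (bd X (subxx _)) z zb; rewrite in_setU1 => /orP[/eqP Ez|//].
  subst z; apply/negPn/negP => xb.
  have : boundary e (y |: X) \subset y |: (boundary e X :\ x).
    apply/subsetP => t tb; move: (subsetP (boundary_setU1 e X y) t tb).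
    rewrite !in_setU1 in_setD1; have [Et|_ ->//] := eqVneq t x.
    subst t; have /boundaryP[_ [u]] := tb; rewrite in_setU1 negb_or => /andP[uy uX] exu.
    case/negP: xb; apply/boundaryP; split=> //; exists u => //=.
    rewrite exu !xpair_eqE (negbTE uy) !andbF /= negb_and.
    by apply/orP; right; apply: contraNneq uX => ->.
  move=> /subset_leq_card le_b; case/negP: ncZ; rewrite eqn_leq minA ?subsetUr // andbT.
  apply: leq_trans le_b _; rewrite -cX (cardsD1 x (boundary e X)) zb cardsU1.
  by rewrite leq_add2r leq_b1.
have ff' : rooted_family e' X f.
  case: ff => fX fc fb fdis; split=> //; last by rewrite bX.
  move=> i iA a b af bf; apply: connect_sub (fc i iA a b af bf) => c d /and3P[cf df ecd].
  have cX' := subsetP (fX i iA) c cf; have dX := subsetP (fX i iA) d df.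
  apply: connect1; rewrite /= cf df ecd !xpair_eqE.
  have -> : d == y = false by apply: contraNF yX => /eqP<-.
  have -> : c == y = false by apply: contraNF yX => /eqP<-.
  by rewrite andbF.
have [||||f' ff1 sf] := IH e' X Y f _ syme' sXY ff' _ _ _.
- rewrite -ltnS; apply: leq_trans le_n; rewrite ltnS ltn_add2l.
  apply: proper_card; apply/properP; split.
    by apply/subsetP => p; rewrite !inE => /se'.
  by exists (x, y); rewrite !inE /= ?exy ?eqxx ?andbF.
- by rewrite bX.
- by rewrite bY.
(* Strictly between [X] and [Y], [none] makes every boundary larger than [#|A|], so it can afford to
   lose [x]. *)
- move=> Z sXZ sZY; have [<-|nXZ] := eqVneq X Z; first by rewrite bX cX.
  have [->|nZY] := eqVneq Z Y; first by rewrite bY cY.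
  have lt_AZ : #|A| < #|boundary e Z|.
    rewrite ltn_neqAle minA // andbT eq_sym.
    by apply: contra none => cZ; apply/existsP; exists Z; rewrite sXZ sZY nXZ nZY.
  rewrite -ltnS; apply: leq_trans lt_AZ _; apply: leq_trans (subset_leq_card (bd Z sXZ)) _.
  by rewrite cardsU1 -add1n leq_add2r leq_b1.
exists f'; last by [].
case: ff1 => fX fc fb fdis; split=> //; last by rewrite -bY.
by move=> i iA; apply: connected_rel_sub se' (fc i iA).
Qed.

End Linkage.

(** * Growing a model of the tree *)

Section ExcludedTree.
Variables (V T : finType) (adjV : rel V) (adjT : rel T).
Hypotheses (symV : symmetric adjV) (symT : symmetric adjT).
Hypothesis irrT : irreflexive adjT.
Hypothesis connT : forall x y, connect adjT x y.
Hypothesis acyclicT : forall c : seq T, uniq c -> cycle adjT c -> size c < 3.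

(** A path from [a] to [b] inside [A] avoids [v]; if [a] and [b] differ, it closes a cycle through
    [v]. *)
Lemma tree_unique_nbr (A : {set T}) v a b :
  connected_rel adjT A -> v \notin A -> a \in A -> b \in A ->
  adjT v a -> adjT v b -> a = b.
Proof.
move=> cA vA aA bA va vb; have /connectP[p0 path0 last0] := cA a b aA bA.
have [p [pathp uniqp lastp]] : exists p,
    [/\ path [rel x y | [&& x \in A, y \in A & adjT x y]] a p, uniq (a :: p) & last a p = b].
  by case/shortenP: path0 last0 => p pathp up _ ->; exists p.
have subA : {subset p <= A}.
  move=> x xp; have [p1 [p2 E]] : exists p1 p2, p = p1 ++ x :: p2.
    by case/splitPr: xp => p1 p2; exists p1, p2.
  by move: pathp; rewrite E cat_path => /andP[_ /andP[/and3P[_ xA _] _]].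
have pathT : path adjT a p by apply: sub_path pathp => x y /and3P[].
have := acyclicT (c := v :: a :: p); case: p => [//|c p] in pathp lastp uniqp subA pathT *.
suff H : uniq [:: v, a, c & p] && cycle adjT [:: v, a, c & p].
  by case/andP: H => H1 H2 /(_ H1 H2).
apply/andP; split.
  rewrite cons_uniq uniqp andbT inE negb_or; apply/andP; split.
    by apply: contraNneq vA => ->.
  by apply: contra vA => /subA.
move: pathT; rewrite /= => /andP[ac pcp]; rewrite va ac rcons_path pcp /=.
by move: lastp => /= ->; rewrite symT.
Qed.

(** The invariant of the construction: a model of the part of the tree induced by [A], with [X] so
    large that every admissible proper extension has more than [#|A|] boundary vertices. *)
Definition rooted_model k (A : {set T}) (X : {set V}) (f : T -> {set V}) : Prop :=
  [/\ admissible adjV k X,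
      forall Z, admissible adjV k Z -> X \subset Z -> #|boundary adjV Z| <= #|A| -> Z = X,
      #|boundary adjV X| = #|A|,
      rooted_family A adjV X f &
      {in A &, forall s t, adjT s t ->
        exists x y, [/\ x \in f s, y \in f t & adjV x y]}].

Lemma maximal_admissible k m X :
  admissible adjV k X -> #|boundary adjV X| <= m ->
  exists Y : {set V}, [/\ X \subset Y, admissible adjV k Y, #|boundary adjV Y| <= m &
    forall Z, admissible adjV k Z -> Y \subset Z -> #|boundary adjV Z| <= m -> Z = Y].
Proof.
move=> admX bX.
pose P := [pred Z : {set V} | `[< admissible adjV k Z >] && (#|boundary adjV Z| <= m)].
have PX : P X by rewrite /= bX andbT; apply/asboolP.
have [Y /maxsetP[/andP[/asboolP admY bY] maxY] sXY] := maxset_exists PX.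
exists Y; split=> // Z admZ sYZ bZ; apply: maxY => //.
by rewrite /= bZ andbT; apply/asboolP.
Qed.

Lemma rooted_model0 k : exists X f, rooted_model k set0 X f.
Proof.
have [|Y [_ admY bY maxY]] := @maximal_admissible k 0 set0 (admissible0 _ _).
  by rewrite boundary0 cards0.
exists Y, (fun=> set0); split; rewrite ?cards0 //; first by apply/eqP; rewrite -leqn0.
  by split=> i; rewrite inE.
by move=> i j; rewrite inE.
Qed.

(* The new branch set starts as a neighbour [y] outside [X] of the root of the
   branch set of [u]; maximality of [X] makes the boundary grow. *)
Lemma rooted_modelU1 k (A : {set T}) (v : T) X f :
  ~ admissible adjV k [set: V] -> #|A| < k ->
  connected_rel adjT A -> v \notin A ->
  (A = set0) \/ (exists2 u, u \in A & adjT v u) ->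
  rooted_model k A X f ->
  exists X' f', rooted_model k (v |: A) X' f'.
Proof.
move=> nadm ltA cA vA nbr [admX maxX cX ff model]; case: (ff) => fX fc fb fdis.
have cvA : #|v |: A| = #|A|.+1 by rewrite cardsU1 vA.
(* Since [v] has only one neighbour in [A], a neighbour of a single root provides all adjacencies;
   if [A] is empty, any [y] outside [X] will do. *)
have [y yX ynbr] : exists2 y, y \notin X &
    {in A, forall u, adjT v u -> exists2 x, x \in f u & adjV x y}.
  case: nbr => [A0|[u uA vu]].
    have [y yX] : exists y, y \notin X.
      have : ~~ ([set: V] \subset X).
        by apply/negP; rewrite subTset => /eqP XT; apply: nadm; rewrite -XT.
      by move/subsetPn => [y _ yX]; exists y.
    by exists y => // u; rewrite A0 inE.
  have [x xf /boundaryP[xX [y yX exy]]] := fb u uA.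
  by exists y => // t tA vt; exists x => //; rewrite (tree_unique_nbr cA vA tA uA vt vu).
have bsub := boundary_setU1 adjV X y.
have ynX : y \notin boundary adjV X by apply: contra yX => /boundaryP[].
have cb : #|y |: boundary adjV X| = #|v |: A| by rewrite cardsU1 ynX cX cvA.
have admX' : admissible adjV k (y |: X).
  by constructor=> //; apply: leq_trans (subset_leq_card bsub) _; rewrite cb cvA.
have small Z : admissible adjV k Z -> y |: X \subset Z -> #|v |: A| <= #|boundary adjV Z|.
  move=> admZ sXZ; rewrite cvA ltnNge; apply/negP => bZ.
  have EZ : Z = X by apply: maxX => //; apply: subset_trans (subsetUr _ _) sXZ.
  by move: sXZ; rewrite EZ subUset sub1set (negbTE yX).
have eb : boundary adjV (y |: X) = y |: boundary adjV X.
  by apply/eqP; rewrite eqEcard bsub cb small.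
have [|Y [sXY admY bY maxY]] := @maximal_admissible k #|v |: A| (y |: X) admX'.
  by rewrite eb cb.
(* A set of minimal boundary between [y |: X] and [Y] is admissible by [admissible_sub], so [small]
   applies to it. *)
have minA (Z : {set V}) : y |: X \subset Z -> Z \subset Y -> #|v |: A| <= #|boundary adjV Z|.
  move=> sXZ sZY.
  pose P := [pred W : {set V} | (y |: X \subset W) && (W \subset Y)].
  have PZ : P Z by rewrite /= sXZ sZY.
  case: (arg_minnP (fun W => #|boundary adjV W|) PZ) => W /andP[sXW sWY] minW.
  apply: leq_trans (minW Z PZ); apply: small => //.
  apply: admissible_sub admY sWY _ => U sWU sUY; apply: minW.
  by rewrite /= sUY (subset_trans sXW).
have cY : #|boundary adjV Y| = #|v |: A|.
  by apply/eqP; rewrite eqn_leq bY minA.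
pose f1 t := if t == v then [set y] else f t.
have Av t : t \in A -> (t == v) = false by move=> tA; apply: contraNF vA => /eqP<-.
have yf t : t \in A -> y \notin f t.
  by move=> tA; apply: contra yX; apply: (subsetP (fX t tA)).
have ff1 : rooted_family (v |: A) adjV (y |: X) f1.
  split.
  - move=> t /setU1P[->|tA]; rewrite /f1 ?eqxx; first by rewrite sub1set setU11.
    by rewrite Av // subsetU // fX ?orbT.
  - move=> t /setU1P[->|tA]; rewrite /f1 ?eqxx; first exact: connected_rel1.
    by rewrite Av //; apply: fc.
  - move=> t; rewrite eb => /setU1P[->|tA]; rewrite /f1 ?eqxx.
      by exists y; rewrite ?set11 ?setU11.
    by rewrite Av //; have [x xf xb] := fb t tA; exists x => //; rewrite in_setU1 xb orbT.
  - move=> s t /setU1P[->|sA] /setU1P[->|tA]; rewrite /f1 ?eqxx ?Av // => nst.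
    + by rewrite disjoints1 yf.
    + by rewrite disjoint_sym disjoints1 yf.
    + exact: fdis.
have model1 : {in v |: A &, forall s t, adjT s t ->
    exists x z, [/\ x \in f1 s, z \in f1 t & adjV x z]}.
  move=> s t /setU1P[->|sA] /setU1P[->|tA]; rewrite /f1 ?eqxx ?Av // => st.
  - by rewrite irrT in st.
  - have [x xf exy] := ynbr t tA st; exists y, x; split=> //; first exact: set11.
    by rewrite symV.
  - by rewrite symT in st; have [x xf exy] := ynbr s sA st; exists x, y; rewrite set11.
  - exact: model.
have [|f2 ff2 sf2] := rooted_family_link symV sXY ff1 _ cY minA.
  by rewrite eb cb.
exists Y, f2; split=> // s t sA tA st.
have [x [z [xs zt xz]]] := model1 s t sA tA st.
by exists x, z; rewrite (subsetP (sf2 s sA)) // (subsetP (sf2 t tA)).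
Qed.

(** If the whole vertex set is not admissible, the model can be extended by one tree vertex at a
    time, keeping [A] connected, until it models the entire tree. *)
Lemma admissible_excluded_tree :
  ~ (exists B : T -> {set V},
    [/\ forall t, B t != set0,
        forall t, connected_rel adjV (B t),
        forall s t, s != t -> [disjoint B s & B t] &
        forall s t, adjT s t -> exists x y, [/\ x \in B s, y \in B t & adjV x y]]) ->
  admissible adjV #|T| [set: V].
Proof.
move=> noB; apply: contrapT => nadm; apply: noB.
have grow m : m <= #|T| -> exists (A : {set T}) X f,
    [/\ #|A| = m, connected_rel adjT A & rooted_model #|T| A X f].
  elim: m => [_|m IH lt_m].
    have [X [f]] := rooted_model0 #|T|.
    by exists set0, X, f; split; rewrite ?cards0 // => x; rewrite inE.
  have [A [X [f [cA connA model]]]] := IH (ltnW lt_m).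
  have [v vA nbr] : exists2 v, v \notin A & A = set0 \/ exists2 u, u \in A & adjT v u.
    have /subsetPn[b _ bA] : ~~ ([set: T] \subset A).
      by apply: contraTN lt_m => /subset_leq_card; rewrite cardsT cA -leqNgt.
    have [->|[a aA]] := set_0Vmem A; first by exists b; rewrite ?inE //; left.
    have [/existsP[[v u] /and3P[/= vA uA vu]]|none] :=
        boolP [exists p, [&& p.1 \notin A, p.2 \in A & adjT p.1 p.2]].
      by exists v => //; right; exists u.
    have clA : closed adjT (mem A).
      apply: intro_closed => [|x y xy xA]; first exact: sym_connect_sym.
      apply: contraR none => yA; apply/existsP; exists (y, x).
      by rewrite /= yA xA symT xy.
    by move: bA; rewrite -(closed_connect clA (connT a b)) aA.
  have ltA : #|A| < #|T| by rewrite cA.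
  have [X' [f' model']] :=
    rooted_modelU1 nadm ltA connA vA nbr model.
  exists (v |: A), X', f'; split=> //.
    by rewrite cardsU1 vA cA.
  case: nbr => [->|[u uA vu]]; first by rewrite setU0; apply: connected_rel1.
  by apply: (connected_relU1 symT connA uA); rewrite symT.
have [A [X [f [cA _ [_ _ _ [fX fc fb fdis] model]]]]] := grow #|T| (leqnn _).
have AT t : t \in A.
  suff /eqP-> : A == [set: T] by rewrite inE.
  by rewrite eqEcard subsetT cardsT cA /=.
exists f; split=> [t|t|s t|s t].
- by have [x xf _] := fb t (AT t); apply/set0Pn; exists x.
- exact: fc.
- exact: fdis.
- exact: model.
Qed.

End ExcludedTree.

(** * From construction orders to path decompositions *)

Section Intervals.
Variables (V : finType) (adjV : rel V).
Hypothesis symV : symmetric adjV.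

(* A path decomposition, given by the first and the last bag containing [v]. *)
Definition interval_rep (lo hi : V -> nat) : Prop :=
  (forall v, lo v <= hi v) /\ (forall u v, adjV u v -> lo u <= hi v).

Definition thin (lo hi : V -> nat) (X : {set V}) (m : nat) : Prop :=
  forall t, #|[set v in X | lo v <= t <= hi v]| <= m.

(** List the vertices in the order of their addition and keep each one from its own position up to
    that of its last neighbour. The bag at [t] then consists of boundary vertices of the first [t]
    vertices and possibly the vertex at position [t], hence [k.+1]. *)
Lemma admissible_intervals k : admissible adjV k [set: V] ->
  exists lo hi, interval_rep lo hi /\ thin lo hi [set: V] k.+1.
Proof.
move=> adm.
have [s [us memT bs]] : exists s : seq V, [/\ uniq s, [set:: s] = [set: V] &
    forall i, #|boundary adjV [set:: take i s]| <= k].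
  elim: adm => [|X y admX [s [us <- bs]] by_].
    have E0 : [set:: [::]] = set0 :> {set V} by apply/setP => x; rewrite !inE.
    by exists [::]; split=> // i; rewrite E0 boundary0 cards0.
  have [ys|ys] := boolP (y \in s).
    exists s; split=> //; apply/setP => x; rewrite !inE.
    by case: eqP => [->|].
  exists (rcons s y); split; first by rewrite rcons_uniq ys.
    by apply/setP => x; rewrite !inE mem_rcons inE.
  move=> i; have [le_i|lt_i] := leqP i (size s).
    by rewrite -cats1 takel_cat // bs.
  rewrite take_oversize ?size_rcons //.
  rewrite (_ : [set:: _] = y |: [set:: s]) //.
  by apply/setP => x; rewrite !inE mem_rcons inE.
have ms v : v \in s by have := in_setT v; rewrite -memT inE.
pose hi v := \max_(u | (u == v) || adjV u v) index u s.
exists (index^~ s), hi; split.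
  split=> [v|u v uv]; first by apply: (leq_bigmax_cond (F := index^~ s)); rewrite eqxx.
  by apply: (leq_bigmax_cond (F := index^~ s)); rewrite uv orbT.
move=> t; set S := [set v in _ | _].
have [->|[x0 _]] := set_0Vmem S; first by rewrite cards0.
apply: leq_trans (_ : #|nth x0 s t |: boundary adjV [set:: take t s]| <= _); last first.
  by rewrite cardsU1; have := bs t; case: (_ \notin _) => /=; lia.
apply/subset_leq_card/subsetP => v; rewrite !inE /= => /andP[le_vt le_tv].
have [<-|nvt] := eqVneq (index v s) t; first by rewrite nth_index ?eqxx.
have lt_vt : index v s < t by rewrite ltn_neqAle nvt.
apply/orP; right; rewrite in_take // lt_vt /=.
have [|u uv hu] := @eq_bigmax_cond _ [pred u | (u == v) || adjV u v] (index^~ s).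
  by apply/card_gt0P; exists v; rewrite inE eqxx.
rewrite /hi hu in le_tv; apply/existsP; exists u.
rewrite inE in_take // -leqNgt le_tv /= symV.
by case/predU1P: uv => // uv; move: lt_vt; rewrite -uv ltnNge le_tv.
Qed.

End Intervals.

Import Order.TTheory GRing.Theory Num.Theory.
Local Open Scope ring_scope.

(** * Linear inequalities *)

Section Farkas.
Variable R : realFieldType.

Lemma exists_between (I : finType) (P Q : pred I) (f g : I -> R) :
  (forall i j, P i -> Q j -> f i <= g j) ->
  exists t, (forall i, P i -> f i <= t) /\ (forall j, Q j -> t <= g j).
Proof.
move=> fg; have [/existsP[i0 Pi0]|noP] := boolP [exists i, P i].
  case: (arg_maxP f Pi0) => i Pi maxf; exists (f i); split=> [k Pk|j Qj].
    exact: maxf.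
  exact: fg.
have [/existsP[j0 Qj0]|noQ] := boolP [exists j, Q j].
  case: (arg_minP g Qj0) => j Qj ming; exists (g j); split=> [i Pi|k Qk].
    by case/existsP: noP; exists i.
  exact: ming.
exists 0; split=> i Hi; [case/existsP: noP | case/existsP: noQ]; by exists i.
Qed.

(** Variables are indexed by [nat] with only the first [n] in use, so that eliminating the last one
    does not change the index type. *)
Definition feasible n (I : finType) (A : I -> nat -> R) (b : I -> R) : Prop :=
  exists x : nat -> R, forall i, \sum_(j < n) A i j * x j <= b i.

Definition refutable n (I : finType) (A : I -> nat -> R) (b : I -> R) : Prop :=
  exists y : I -> R, [/\ forall i, 0 <= y i,
    forall j, (j < n)%N -> \sum_i y i * A i j = 0 & \sum_i y i * b i < 0].

(* Fourier-Motzkin elimination of the last variable: the new constraints are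
   nonnegative combinations of the old ones, with coefficients [c]. *)
Lemma feasible_or_refutable n (I : finType) (A : I -> nat -> R) (b : I -> R) :
  feasible n A b \/ refutable n A b.
Proof.
elim: n I A b => [|n IH] I A b.
  have [/existsP[i0 lt_b]|nolt] := boolP [exists i, b i < 0].
    right; exists (fun i => (i == i0)%:R); split=> //.
    by rewrite (bigD1 i0) //= eqxx mul1r big1 ?addr0 // => i /negbTE->; rewrite mul0r.
  left; exists (fun=> 0) => i; rewrite big_ord0 leNgt.
  by apply: contra nolt => lt_b; apply/existsP; exists i.
pose c (k : I + I * I) (i : I) : R := match k with
  | inl i1 => (A i1 n == 0)%:R * (i == i1)%:R
  | inr (i1, i2) => ((0 < A i1 n) && (A i2 n < 0))%R%:R *
                    (- A i2 n * (i == i1)%:R + A i1 n * (i == i2)%:R)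
  end.
have delta (F : I -> R) i1 : \sum_i (i == i1)%:R * F i = F i1.
  by rewrite (bigD1 i1) //= eqxx mul1r big1 ?addr0 // => i /negbTE->; rewrite mul0r.
have cl F i1 : \sum_i c (inl i1) i * F i = (A i1 n == 0)%:R * F i1.
  by under eq_bigr do rewrite /= -mulrA; rewrite -mulr_sumr delta.
have cr F i1 i2 : \sum_i c (inr (i1, i2)) i * F i =
    ((0 < A i1 n) && (A i2 n < 0))%R%:R * (- A i2 n * F i1 + A i1 n * F i2).
  rewrite -(delta F i1) -(delta F i2) 2!mulr_sumr -big_split mulr_sumr.
  by apply: eq_bigr => i _ /=; rewrite -mulrA; congr (_ * _); rewrite mulrDl !mulrA.
have c_ge0 k i : 0 <= c k i.
  case: k => [i1|[i1 i2]] /=; first by rewrite mulr_ge0.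
  have [/andP[A1 A2]|_] := boolP (_ && _); last by rewrite mul0r.
  by rewrite mul1r addr_ge0 // mulr_ge0 ?oppr_ge0 // ltW.
pose A' k j := \sum_i c k i * A i j.
pose b' k := \sum_i c k i * b i.
have [[x xP]|[y [y_ge0 yA yb]]] := IH (I + I * I)%type A' b'; [left | right].
  (* [r i] is what constraint [i] leaves for the last variable; the combined constraints say that
     every lower bound obtained for it is at most every upper bound. *)
  pose r i := b i - \sum_(j < n) A i j * x j.
  have cr_ge0 k : 0 <= \sum_i c k i * r i.
    have -> : \sum_i c k i * r i = b' k - \sum_(j < n) A' k j * x j.
      rewrite /r /b'; under eq_bigr do rewrite mulrBr; rewrite sumrB; congr (_ - _).
      under eq_bigr do rewrite mulr_sumr; rewrite exchange_big; apply: eq_bigr => j _ /=.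
      by rewrite mulr_suml; apply: eq_bigr => i _; rewrite mulrA.
    by rewrite subr_ge0.
  have [|t [t_ge t_le]] := @exists_between I (fun i => A i n < 0) (fun i => 0 < A i n)
      (fun i => r i / A i n) (fun i => r i / A i n).
    move=> i2 i1 A2 A1; have := cr_ge0 (inr (i1, i2)); rewrite cr A1 A2 mul1r => h.
    by rewrite ler_pdivlMr // mulrAC ler_ndivrMr //; lra.
  exists (fun j => if j == n then t else x j) => i.
  rewrite big_ord_recr /= eqxx.
  under eq_bigr => j _ do rewrite (ltn_eqF (ltn_ord j)).
  rewrite -lerBrDl -/(r i).
  have [lt_A|gt_A|eq_A] := ltgtP (A i n) 0.
  - by rewrite mulrC -ler_ndivrMr // t_ge.
  - by rewrite mulrC -ler_pdivlMr // t_le.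
  - by have := cr_ge0 (inl i); rewrite cl eq_A eqxx mul1r mul0r.
exists (fun i => \sum_k y k * c k i).
have swap F : \sum_i (\sum_k y k * c k i) * F i = \sum_k y k * \sum_i c k i * F i.
  under eq_bigr do rewrite mulr_suml; rewrite exchange_big; apply: eq_bigr => k _ /=.
  by rewrite mulr_sumr; apply: eq_bigr => i _; rewrite mulrA.
split=> [i|j|]; last by rewrite swap.
  by apply: sumr_ge0 => k _; rewrite mulr_ge0.
(* The eliminated variable cancels in each combined constraint, so its column vanishes. *)
rewrite swap ltnS leq_eqVlt => /predU1P[->|lt_jn]; last exact: yA.
apply: big1 => -[i1|[i1 i2]] _; rewrite ?cl ?cr.
  by have [->|_] := eqVneq (A i1 n) 0; rewrite ?mul0r !mulr0.
by rewrite (_ : - _ * _ + _ = 0) ?mulr0 // mulrC mulrN addNr.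
Qed.

Lemma farkas (I J : finType) (A : I -> J -> R) (b : I -> R) :
  (exists x : J -> R, forall i, \sum_j A i j * x j <= b i) \/
  (exists y : I -> R, [/\ forall i, 0 <= y i,
     forall j, \sum_i y i * A i j = 0 & \sum_i y i * b i < 0]).
Proof.
pose A' i k := if insub k is Some o then A i (enum_val (o : 'I_#|J|)) else 0.
have A'E i (o : 'I_#|J|) : A' i o = A i (enum_val o) by rewrite /A' valK.
have [[x xP]|[y [y_ge0 yA yb]]] := feasible_or_refutable #|J| A' b; [left | right].
  exists (fun j => x (enum_rank j)) => i; apply: le_trans (xP i).
  rewrite (reindex (fun k : 'I_#|J| => enum_val k)) /=; last by apply: onW_bij; apply: enum_val_bij.
  by under eq_bigr do rewrite enum_valK -A'E.
exists y; split=> // j; rewrite -[RHS](yA (enum_rank j)) //.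
by apply: eq_bigr => i _; rewrite A'E enum_rankK.
Qed.

End Farkas.

(** * Cut metrics *)

Section CutMetrics.
Variables (R : realFieldType) (V : finType).
Implicit Types (lam : {set V} -> R) (a b : V -> R).

Definition cut_metric lam (u v : V) : R :=
  \sum_(S : {set V}) lam S * `|(u \in S)%:R - (v \in S)%:R|.

Lemma cut_metricD lam1 lam2 u v :
  cut_metric (fun S => lam1 S + lam2 S) u v = cut_metric lam1 u v + cut_metric lam2 u v.
Proof. by rewrite -big_split; apply: eq_bigr => S _; rewrite mulrDl. Qed.

Lemma cut_metric_ge0 lam u v : (forall S, 0 <= lam S) -> 0 <= cut_metric lam u v.
Proof. by move=> lam0; apply: sumr_ge0 => S _; rewrite mulr_ge0. Qed.

(** Indices with the same set are merged by adding their weights. *)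
Lemma cut_metric_family (I : finType) (mu : I -> R) (S_ : I -> {set V}) :
  (forall i, 0 <= mu i) -> exists2 lam, (forall S, 0 <= lam S) &
    forall u v, cut_metric lam u v =
      \sum_i mu i * `|(u \in S_ i)%:R - (v \in S_ i)%:R|.
Proof.
move=> mu0; exists (fun S => \sum_i mu i * (S == S_ i)%:R).
  by move=> S; apply: sumr_ge0 => i _; rewrite mulr_ge0.
move=> u v; rewrite /cut_metric; under eq_bigr do rewrite mulr_suml.
rewrite exchange_big; apply: eq_bigr => i _ /=.
rewrite (bigD1 (S_ i)) //= eqxx mulr1 big1 ?addr0 // => S /negbTE->.
by rewrite mulr0 mul0r.
Qed.

Lemma sorted_nth_le (s : seq R) i j :
  sorted <=%R s -> (i <= j < size s)%N -> s`_i <= s`_j.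
Proof.
move=> ss /andP[ij js]; apply: (sorted_leq_nth le_trans le_refl 0 ss) => //.
by rewrite inE; apply: leq_ltn_trans js.
Qed.

(** As [q] is an entry, the gap after each entry lies entirely below or entirely above [q];
    truncating the entries at [q] makes the sum telescope. *)
Lemma sum_gaps (s : seq R) q : sorted <=%R s -> q \in s ->
  \sum_(i < (size s).-1) (s`_i.+1 - s`_i) * (s`_i < q)%R%:R = q - s`_0.
Proof.
move=> ss qs; have le_s i j := @sorted_nth_le s i j ss.
have Eq : s`_(index q s) = q by rewrite nth_index.
have qsz : (index q s < size s)%N by rewrite index_mem.
transitivity (\sum_(0 <= i < (size s).-1) (Num.min (s`_i.+1) q - Num.min (s`_i) q)).
  rewrite big_mkord; apply: eq_bigr => i _.
  have [lt_iq|le_qi] := ltP (s`_i) q.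
    rewrite mulr1 min_l // -Eq le_s // qsz andbT ltnNge.
    by apply: contraTN lt_iq => le_ji; rewrite -leNgt -Eq le_s // le_ji; have := ltn_ord i; lia.
  rewrite mulr0 min_r ?subrr //; apply: le_trans le_qi _.
  by apply: le_s; have := ltn_ord i; lia.
rewrite telescope_sumr //.
have q_le : q <= s`_(size s).-1 by rewrite -[X in X <= _]Eq le_s //; lia.
have q_ge : s`_0 <= q by rewrite -[X in _ <= X]Eq le_s.
by rewrite (min_r q_le) (min_l q_ge).
Qed.

Let ltW_imply (x y z : R) : y <= z -> (x < y) ==> (x < z).
Proof. by move=> yz; apply/implyP => xy; apply: lt_le_trans yz. Qed.

(** In this and the next two facts, [p], [q], [r], [s] say that a point lies below [a u], [b u],
    [a v], [b v], up to exchanging [u] and [v]; so [q - p] and [s - r] are the indicators of the two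
    intervals. *)
Let indicator_dist_le (p q r s : bool) : p ==> q -> r ==> s ->
  `|(q%:R - p%:R) - (s%:R - r%:R)| <= (q%:R - p%:R) + (s%:R - r%:R) :> R.
Proof.
case: p; case: q; case: r; case: s => //= _ _.
all: by rewrite ?(subrr, subr0, sub0r, addr0, add0r, normrN, normr0, normr1, oppr0, opprK)
  ?lexx ?ler01 ?addr_ge0 ?ler01.
Qed.

Let indicator_disjoint (p q r s : bool) : p ==> q -> r ==> s -> (q ==> r) || (s ==> p) ->
  (q%:R - p%:R) + (s%:R - r%:R) <= `|(q%:R - p%:R) - (s%:R - r%:R)| :> R.
Proof.
case: p; case: q; case: r; case: s => //= _ _ _.
all: by rewrite ?(subrr, subr0, sub0r, addr0, add0r, normrN, normr0, normr1, oppr0, opprK).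
Qed.

Let indicator_crossing (p q r s : bool) : p ==> r -> r ==> q -> q ==> s ->
  (r%:R - p%:R) + (s%:R - q%:R) <= `|(q%:R - p%:R) - (s%:R - r%:R)| :> R.
Proof.
case: p; case: q; case: r; case: s => //= _ _ _.
all: by rewrite ?(subrr, subr0, sub0r, addr0, add0r, normrN, normr0, normr1, oppr0, opprK).
Qed.

(* [cut_metric lam u v] is the length of the symmetric difference of the
   intervals [a u, b u[ and [a v, b v[. *)
Lemma interval_cut_metric a b : (forall u, a u <= b u) ->
  exists lam, [/\ forall S, 0 <= lam S,
    forall u v, cut_metric lam u v <= `|a u - a v| + `|b u - b v|,
    forall u v, cut_metric lam u v <= (b u - a u) + (b v - a v) &
    forall u v, Num.min `|(a u + b u) - (a v + b v)| ((b u - a u) + (b v - a v))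
                <= cut_metric lam u v].
Proof.
(* All endpoints cut the line into elementary intervals; each contributes the cut formed by the
   vertices whose intervals cover it, weighted by its length. *)
move=> ab; pose s := sort <=%R ([seq a u | u : V] ++ [seq b u | u : V]).
have ss : sorted <=%R s by apply: sort_sorted; apply: le_total.
have as_ u : a u \in s by rewrite mem_sort mem_cat map_f ?mem_enum.
have bs_ u : b u \in s by rewrite mem_sort mem_cat map_f ?orbT ?mem_enum.
pose mu (i : 'I_(size s).-1) := s`_i.+1 - s`_i.
have mu0 i : 0 <= mu i.
  by rewrite subr_ge0; apply: sorted_nth_le; rewrite // leqnSn -ltn_predRL ltn_ord.
have [lam lam0 E] :=
  cut_metric_family (fun i : 'I_(size s).-1 => [set u | a u <= s`_i < b u]%R) mu0.
exists lam; pose I q (i : 'I_(size s).-1) : R := (s`_i < q)%R%:R.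
pose M f := \sum_i mu i * f i.
have MI q : q \in s -> M (I q) = q - s`_0 by move=> qs; rewrite -(sum_gaps ss qs).
have MB f g : M (fun i => f i - g i) = M f - M g.
  by rewrite /M -sumrB; apply: eq_bigr => i _; rewrite mulrBr.
have MD f g : M (fun i => f i + g i) = M f + M g.
  by rewrite /M -big_split; apply: eq_bigr => i _; rewrite mulrDr.
have leM f g : (forall i, f i <= g i) -> M f <= M g.
  by move=> fg; apply: ler_sum => i _; rewrite ler_wpM2l.
have {}E u v : cut_metric lam u v =
    M (fun i => `|(I (b u) i - I (a u) i) - (I (b v) i - I (a v) i)|).
  rewrite E; apply: eq_bigr => i _; congr (_ * `|_|); rewrite !inE /I.
  have ind w : (a w <= s`_i < b w)%R%:R = (s`_i < b w)%R%:R - (s`_i < a w)%R%:R :> R.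
    have := ab w; case: (leP (a w)) => ?; case: (ltP _ (b w)) => ? ?; rewrite /= ?subrr ?subr0 //.
    by exfalso; lra.
  by rewrite !ind.
have Mabs p q : p \in s -> q \in s -> M (fun i => `|I p i - I q i|) = `|p - q|.
  move=> ps qs; wlog le_qp : p q ps qs / q <= p.
    move=> H; have [/H-> //|/ltW /H E'] := leP q p.
    rewrite distrC -E' //; apply: eq_bigr => i _; by rewrite distrC.
  rewrite ger0_norm ?subr_ge0 // (_ : p - q = M (fun i => I p i - I q i)); last first.
    by rewrite MB !MI //; lra.
  apply: eq_bigr => i _; congr (_ * _); rewrite ger0_norm // subr_ge0 ler_nat.
  by case: (ltP _ q) => // /lt_le_trans -> .
split=> // u v; rewrite E.
- rewrite -!Mabs // -MD; apply: leM => i; rewrite [leRHS]addrC.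
  by apply: le_trans (ler_normB _ _); rewrite le_eqVlt; apply/orP; left; apply/eqP; congr `|_|; lra.
- have [<- <-] : M (I (b u)) - M (I (a u)) = b u - a u /\ M (I (b v)) - M (I (a v)) = b v - a v.
    by rewrite !MI //; split; lra.
  rewrite -!MB -MD; apply: leM => i.
  by apply: indicator_dist_le; apply: ltW_imply.
- set D := fun i => _.
  have E4 f g h k : f \in s -> g \in s -> h \in s -> k \in s ->
      M (fun i => (I f i - I g i) + (I h i - I k i)) = (f - g) + (h - k).
    by move=> fs gs hs ks; rewrite MD !MB !MI //; lra.
  have lenE w : M (fun i => I (b w) i - I (a w) i) = b w - a w.
    by rewrite MB !MI //; lra.
  have := ab u; have := ab v; rewrite ge_min => abv abu.
  have disjoint : (b u <= a v) || (b v <= a u) -> (b u - a u) + (b v - a v) <= M D.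
    move=> dis; rewrite -E4 //; apply: leM => i; apply: indicator_disjoint; try exact: ltW_imply.
    by case/orP: dis => /ltW_imply->; rewrite ?orbT.
  have [le_buav|lt_avbu] := leP (b u) (a v); first by rewrite disjoint ?le_buav ?orbT.
  have [le_bvau|lt_aubv] := leP (b v) (a u); first by rewrite disjoint ?le_bvau ?orbT.
  (* The remaining intervals overlap: they cross in the first and the last case and are nested in
     the other two. *)
  apply/orP; left; rewrite ler_norml -lerNl; apply/andP.
  have [le_a|lt_a] := leP (a u) (a v); have [le_b|lt_b] := leP (b u) (b v).
  + suff : (a v - a u) + (b v - b u) <= M D by split; lra.
    by rewrite -E4 //; apply: leM => i; apply: indicator_crossing; apply: ltW_imply => //; apply: ltW.
  + suff : (b u - a u) - (b v - a v) <= M D by split; lra.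
    by rewrite -!lenE -MB; apply: leM => i; apply: ler_norm.
  + suff : (b v - a v) - (b u - a u) <= M D by split; lra.
    by rewrite -!lenE -MB; apply: leM => i; rewrite /D distrC; apply: ler_norm.
  + suff : (a u - a v) + (b u - b v) <= M D by split; lra.
    rewrite -E4 //; apply: leM => i; rewrite /D distrC.
    by apply: indicator_crossing; apply: ltW_imply => //; apply: ltW.
Qed.

End CutMetrics.

(** * Peeling off geodesics *)

Section WeightedPaths.
Variables (R : realFieldType) (V : finType) (w : V -> V -> R).

Fixpoint path_cost u (p : seq V) : R :=
  if p is v :: p' then w u v + path_cost v p' else 0.

Lemma path_cost_cat u p q :
  path_cost u (p ++ q) = path_cost u p + path_cost (last u p) q.
Proof. by elim: p u => [|v p IH] u /=; rewrite ?add0r // IH addrA. Qed.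

Variable r : rel V.
Hypothesis w_ge0 : forall x y, r x y -> 0 <= w x y.

Lemma path_cost_ge0 u p : path r u p -> 0 <= path_cost u p.
Proof.
by elim: p u => //= v p IH u /andP[uv vp]; rewrite addr_ge0 ?w_ge0 ?IH.
Qed.

Lemma path_cost_shorten u p : path r u p -> exists q,
  [/\ path r u q, last u q = last u p, uniq (u :: q) & path_cost u q <= path_cost u p].
Proof.
elim: p u => [|v p IH] u; first by exists [::].
rewrite /= => /andP[uv /IH[q [vq lq uq cq]]].
have [uq'|uNq] := boolP (u \in v :: q).
  move: vq lq uq cq; case/splitPl: uq' => q1 q2 E.
  rewrite cat_path last_cat E => /andP[vq1 uq2] lq uq cq.
  exists q2; split=> //.
    rewrite -[_ && _]/(uniq (u :: q2)); apply: (@subseq_uniq _ _ (v :: q1 ++ q2)) => //.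
    by rewrite -cat_cons (lastI v q1) E cat_rcons suffix_subseq.
  move: cq; rewrite path_cost_cat E; have := path_cost_ge0 vq1; have := w_ge0 uv; lra.
exists (v :: q); split; rewrite ?cons_uniq ?uNq //=; first by rewrite uv.
by rewrite lerD2l.
Qed.

Definition geodesic u p : Prop :=
  path r u p /\
  forall q, path r u q -> last u q = last u p -> path_cost u p <= path_cost u q.

(** By shortening, only paths with at most [#|V|] steps compete, and these form a finite type. *)
Lemma geodesic_exists u v :
  connect r u v -> exists p, geodesic u p /\ last u p = v.
Proof.
case/connectP => p0 /path_cost_shorten[p1 [up1 lp1 uniq1 _]] Ev.
have size_uniq p : uniq (u :: p) -> (size p <= #|V|)%N.
  by move=> /card_uniqP E; have := max_card [in u :: p]; rewrite E /= => /ltnW.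
pose ok (p : {bseq #|V| of V}) := path r u p && (last u p == v).
have ok1 : ok (Bseq (size_uniq _ uniq1)) by rewrite /ok /= up1 lp1 -Ev eqxx.
case: (arg_minP (fun p : {bseq #|V| of V} => path_cost u p) ok1) => p /andP[up /eqP lp] min_p.
exists p; split=> //; split=> // q uq lq.
have [q' [uq' lq' uniq' cq']] := path_cost_shorten uq.
apply: le_trans cq'; apply: (min_p (Bseq (size_uniq _ uniq'))).
by rewrite /ok /= uq' lq' lq lp eqxx.
Qed.

Lemma geodesic_family :
  exists P : V -> V -> seq V,
    forall u v, connect r u v -> geodesic u (P u v) /\ last u (P u v) = v.
Proof.
have exP u : exists Pu : V -> seq V,
    forall v, connect r u v -> geodesic u (Pu v) /\ last u (Pu v) = v.
  suff /fin_all_exists : forall v, exists p, connect r u v -> geodesic u p /\ last u p = v by [].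
  move=> v; have [/geodesic_exists[p pP]|_] := boolP (connect r u v); first by exists p.
  by exists [::].
exact: fin_all_exists exP.
Qed.

Lemma geodesic_prefix u p1 p2 : geodesic u (p1 ++ p2) -> geodesic u p1.
Proof.
case; rewrite cat_path => /andP[up1 p2P] min_p; split=> // q uq lq.
have := min_p (q ++ p2); rewrite !path_cost_cat cat_path uq lq p2P !last_cat lq => /(_ isT erefl).
by rewrite lerD2r.
Qed.

Lemma geodesic_cost_eq u p q :
  geodesic u p -> geodesic u q -> last u p = last u q -> path_cost u p = path_cost u q.
Proof.
move=> [up min_p] [uq min_q] E; apply/eqP; rewrite eq_le.
by rewrite min_p // min_q.
Qed.

End WeightedPaths.

(** * Removing one geodesic from every component *)

Section Peeling.
Variables (R : realFieldType) (V : finType) (e : rel V) (w : V -> V -> R).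
Hypotheses (sym_e : symmetric e) (sym_w : forall x y, w x y = w y x).
Hypothesis w_ge0 : forall x y, e x y -> 0 <= w x y.
Variables (d : V -> V -> R) (B : R).
Hypotheses (B_ge0 : 0 <= B) (d_le : forall x y, d x y <= B).
Hypothesis sym_d : forall x y, d x y = d y x.
Hypothesis d_path : forall u p, path e u p -> d u (last u p) <= path_cost w u p.
Variables (lo hi : V -> nat).
Hypothesis lohi : interval_rep e lo hi.

(** Intervals of adjacent vertices intersect, so a path cannot jump over the bag [t]. *)
Lemma path_meets_bag u p t : path e u p -> (lo u <= t)%N -> (t <= hi (last u p))%N ->
  exists2 x, x \in u :: p & (lo x <= t <= hi x)%N.
Proof.
case: lohi => _ lohiE; elim: p u => [|v p IH] u /=.
  by move=> _ l h; exists u; rewrite ?mem_head ?l.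
move=> /andP[uv vp] lu h; have [tu|ut] := leqP t (hi u).
  by exists u; rewrite ?mem_head ?lu.
have [|x xp xt] := IH v vp _ h; last by exists x => //; rewrite inE xp orbT.
by apply: leq_trans (ltnW ut); apply: lohiE; rewrite sym_e.
Qed.

(* In every component of [X], the geodesic from a vertex with the leftmost
   interval to one with the rightmost interval meets all the bags. *)
Lemma peel_geodesics (X : {set V}) m : thin lo hi X m.+1 ->
  exists (Y : {set V}) (g : V -> R),
    [/\ Y \subset X, thin lo hi Y m,
        {in X &, forall x y, e x y -> `|g x - g y| <= w x y} &
        {in X :\: Y &, forall x y, d x y <= `|g x - g y|}].
Proof.
move=> thinX; pose r : rel V := fun a b => [&& a \in X, b \in X & e a b].
have re x y : r x y -> e x y by case/and3P.
have r_ge0 x y : r x y -> 0 <= w x y by move=> /re; apply: w_ge0.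
have sym_r : connect_sym r by apply: sym_connect_sym => a b; rewrite /r sym_e andbCA.
have [P PP] := geodesic_family r_ge0.
(* Components of [X] are named by their roots; if [c] names none, [s] and [t] are arbitrary. *)
have /fin_all_exists[s /fin_all_exists[t stP]] : forall c : V, exists s : V, exists t : V,
    forall x, x \in X -> fingraph.root r x = c ->
    [/\ s \in X, fingraph.root r s = c, fingraph.root r t = c & (lo s <= lo x)%N && (hi x <= hi t)%N].
  move=> c; have [/existsP[x0 x0P]|none] := boolP [exists x, (x \in X) && (fingraph.root r x == c)].
    case: (@arg_minnP _ x0 [pred x | (x \in X) && (fingraph.root r x == c)] lo x0P) =>
      s /andP[sX /eqP sc] smin.
    case: (@arg_maxnP _ x0 [pred x | (x \in X) && (fingraph.root r x == c)] hi x0P) =>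
      t /andP[tX /eqP tc] tmax.
    exists s, t => x xX xc; split=> //.
    by apply/andP; split; [apply: smin | apply: tmax]; rewrite /= xX xc eqxx.
  exists c, c => x xX xc; case/existsP: none; exists x; by rewrite xX xc eqxx.
pose S x := s (fingraph.root r x).
have SX x : x \in X -> connect r (S x) x.
  move=> xX; have [_ sc _ _] := stP _ x xX erefl.
  by rewrite -(root_connect sym_r) sc.
pose D x := path_cost w (S x) (P (S x) x).
have PX x : x \in X -> geodesic w r (S x) (P (S x) x) /\ last (S x) (P (S x) x) = x.
  by move=> /SX /PP.
(* Shifting the components by multiples of [K] makes values of [g] in different components differ by
   at least [B], whatever the distances [D] are. *)
pose K := B + \sum_x `|D x|.
have D_le x : `|D x| <= \sum_x `|D x|.
  by rewrite (bigD1 x) //= lerDl sumr_ge0.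
have D_ge0 x : x \in X -> 0 <= D x.
  by move=> /PX[[Px _] _]; apply: path_cost_ge0 Px.
pose g x := D x + K * (enum_rank (fingraph.root r x))%:R.
pose Q := [set x in X | x \in S x :: P (S x) (t (fingraph.root r x))].
have rootE x y : x \in X -> y \in X -> e x y -> fingraph.root r x = fingraph.root r y.
  by move=> xX yX xy; apply/eqP; rewrite (root_connect sym_r) connect1 ///r xX yX.
have stX x : x \in X -> geodesic w r (S x) (P (S x) (t (fingraph.root r x))) /\
    last (S x) (P (S x) (t (fingraph.root r x))) = t (fingraph.root r x).
  move=> xX; apply: PP; have [_ sc tc _] := stP _ x xX erefl.
  by rewrite -(root_connect sym_r) sc tc.
exists (X :\: Q), g; split; first exact: subsetDl.
(* If a vertex [v] remains in the bag [i], the geodesic of its component meets that bag, so the bag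
   has lost a vertex. *)
- move=> i; have [->|[v]] := set_0Vmem [set v in X :\: Q | (lo v <= i <= hi v)%N].
    by rewrite cards0.
  rewrite !inE => /andP[/andP[_ vX] /andP[lv hv]].
  have [sX sc tc /andP[slo thi]] := stP _ v vX erefl.
  have [[pst _] lst] := stX v vX.
  have [||x xp xi] := path_meets_bag (t := i) (sub_path re pst).
  + exact: leq_trans lv.
  + by rewrite lst; apply: leq_trans thi.
  have [xX xc] : x \in X /\ fingraph.root r x = fingraph.root r v.
    have cx : connect r (S v) x.
      move: xp; rewrite inE => /predU1P[->|xp]; first exact: connect0.
      move: pst; case/splitPr: xp => p1 p2; rewrite -cat_rcons cat_path => /andP[p1x _].
      by apply/connectP; exists (rcons p1 x); rewrite ?last_rcons.
    have xc : fingraph.root r x = fingraph.root r v.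
      by rewrite -sc; apply/esym/eqP; rewrite (root_connect sym_r).
    split=> //; case/connectP: cx => p; case/lastP: p => [_ ->//|p y].
    by rewrite rcons_path last_rcons => /andP[_ /and3P[_ yX _]] ->.
  have xQ : x \in Q by rewrite inE xX /S xc.
  rewrite -ltnS; apply: leq_trans (thinX i); apply: proper_card; apply/properP; split.
    by apply/subsetP => z; rewrite !inE => /andP[/andP[_ ->] ->].
  by exists x; rewrite in_set ?xX ?xi // in_setD xQ.
- move=> x y xX yX xy.
  wlog suff H : x y xX yX xy / g y - g x <= w x y.
    rewrite ler_norml; have := H x y xX yX xy; have := H y x yX xX.
    by rewrite sym_e sym_w => /(_ xy); lra.
  rewrite /g (rootE y x) //; last by rewrite sym_e.
  suff : D y <= D x + w x y by lra.
  have [[px _] lx] := PX x xX; have [[py min_y] ly] := PX y yX.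
  have Sxy : S x = S y by rewrite /S (rootE x y).
  (* The geodesic to [x] followed by the edge to [y] competes with the geodesic to [y]. *)
  have := min_y (rcons (P (S x) x) y).
  rewrite ly last_rcons -Sxy rcons_path px lx /r xX yX xy => /(_ isT erefl).
  rewrite /D -Sxy => /le_trans; apply.
  by rewrite -cats1 path_cost_cat lx /= addr0.
- move=> x y; rewrite !in_setD !negb_and !negbK => /andP[+ xX] /andP[+ yX].
  rewrite xX yX !orbF => xQ yQ.
  have [xy|nxy] := eqVneq (fingraph.root r x) (fingraph.root r y); last first.
    wlog lt_xy : x y xX yX xQ yQ nxy /
        (enum_rank (fingraph.root r x) < enum_rank (fingraph.root r y))%N.
      move=> H; have [lt_xy|lt_yx|E] :=
        ltngtP (enum_rank (fingraph.root r x)) (enum_rank (fingraph.root r y)).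
      + exact: H.
      + by rewrite distrC sym_d; apply: H => //; rewrite eq_sym.
      + by move/val_inj/enum_rank_inj: E nxy => ->; rewrite eqxx.
    rewrite distrC; apply: le_trans (ler_norm _); rewrite /g.
    apply: le_trans (d_le x y) _.
    have K_ge0 : 0 <= K by rewrite addr_ge0 // sumr_ge0.
    have : K * (enum_rank (fingraph.root r x)).+1%:R <= K * (enum_rank (fingraph.root r y))%:R.
      by rewrite ler_wpM2l // ler_nat.
    have := D_le x; have := D_ge0 x xX; have := D_ge0 y yX; rewrite -natr1 mulrDr mulr1 /K.
    by move=> Dy Dx; rewrite ger0_norm //; lra.
  have -> : g x - g y = D x - D y by rewrite /g xy; lra.
  have Sxy : S x = S y by rewrite /S xy.
  set p := P (S x) (t (fingraph.root r x)).
  have [gp lp] := stX x xX.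
  (* [D z] is measured along a separately chosen geodesic, but prefixes of [p] are geodesics too and
     have the same cost. *)
  have pos z : z \in X -> S z = S x -> z \in S x :: p ->
      exists2 i, last (S x) (take i p) = z & D z = path_cost w (S x) (take i p).
    move=> zX Sz zp; have [i li] : exists i, last (S x) (take i p) = z.
      move: zp; rewrite inE => /predU1P[->|zp]; first by exists 0%N; rewrite take0.
      exists (index z p).+1; rewrite (take_nth z) ?index_mem // last_rcons nth_index //.
    exists i => //; have [gz lz] := PX z zX; rewrite /D Sz in gz lz *.
    apply: geodesic_cost_eq gz _ _; last by rewrite li lz.
    by apply: (geodesic_prefix (p2 := drop i p)); rewrite cat_take_drop.
  have [i li Di] : exists2 i, last (S x) (take i p) = x & D x = path_cost w (S x) (take i p).
    by apply: pos => //; move: xQ; rewrite inE xX.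
  have [j lj Dj] : exists2 i, last (S x) (take i p) = y & D y = path_cost w (S x) (take i p).
    by apply: pos => //; move: yQ; rewrite inE yX -Sxy -xy.
  have seg a b : (a <= b)%N -> d (last (S x) (take a p)) (last (S x) (take b p)) <=
      path_cost w (S x) (take b p) - path_cost w (S x) (take a p).
    move=> le_ab; have [q E] : exists q, take b p = take a p ++ q.
      by exists (drop a (take b p)); rewrite -[in RHS](take_takel p le_ab) cat_take_drop.
    rewrite E last_cat path_cost_cat addrC addKr; apply: d_path.
    have : path r (S x) (take b p) by have [pp _] := gp; apply: take_path.
    by rewrite E cat_path => /andP[_]; apply: (sub_path re).
  have [le_ij|/ltnW le_ji] := leqP i j.
    rewrite distrC; apply: le_trans (ler_norm _).
    by rewrite Di Dj -[in leLHS]li -lj; apply: seg.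
  apply: le_trans (ler_norm _).
  by rewrite Di Dj sym_d -[in leLHS]li -lj; apply: seg.
Qed.

End Peeling.

(** * Combining the coordinates of all peeling rounds *)

Section ThinEmbedding.
Variables (R : realFieldType) (V : finType) (e : rel V) (w : V -> V -> R).
Hypotheses (sym_e : symmetric e) (sym_w : forall x y, w x y = w y x).
Hypothesis w_ge0 : forall x y, e x y -> 0 <= w x y.
Variables (d : V -> V -> R) (B : R).
Hypotheses (B_ge0 : 0 <= B) (d_le : forall x y, d x y <= B).
Hypotheses (d_refl : forall x, d x x = 0) (sym_d : forall x y, d x y = d y x).
Hypothesis d_triangle : forall y x z, d x z <= d x y + d y z.
Hypothesis d_path : forall u p, path e u p -> d u (last u p) <= path_cost w u p.
Hypothesis d_realized : forall u v, d u v < B ->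
  exists p, [/\ path e u p, last u p = v & path_cost w u p <= d u v].
Variables (lo hi : V -> nat).
Hypothesis lohi : interval_rep e lo hi.

Implicit Types (X : {set V}) (u v : V).

Let d_ge0 x y : 0 <= d x y.
Proof. by have := d_triangle y x x; rewrite d_refl (sym_d y); lra. Qed.

(** The cap [B] is also the value when [X] contains all vertices. *)
Definition exit_dist (X : {set V}) u : R := \big[Num.min/B]_(y | y \notin X) d u y.

Lemma exit_dist_le_bound X u : exit_dist X u <= B.
Proof. exact: bigmin_le_id. Qed.

Lemma exit_dist_le X u y : y \notin X -> exit_dist X u <= d u y.
Proof. by move=> yX; rewrite /exit_dist; apply: bigmin_le_cond. Qed.

Lemma exit_dist_ge X u c :
  c <= B -> (forall y, y \notin X -> c <= d u y) -> c <= exit_dist X u.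
Proof. by move=> cB cd; apply/bigmin_geP; split. Qed.

Lemma exit_dist_ge0 X u : 0 <= exit_dist X u.
Proof. exact: exit_dist_ge. Qed.

Lemma exit_dist_out X u : u \notin X -> exit_dist X u = 0.
Proof.
by move=> uX; apply/eqP; rewrite eq_le exit_dist_ge0 andbT -(d_refl u) exit_dist_le.
Qed.

Lemma exit_dist_lt X u c : c <= B -> exit_dist X u < c -> exists2 y, y \notin X & d u y < c.
Proof.
move=> cB lt_c; have [/existsP[y /andP[yX yc]]|none] := boolP [exists y, (y \notin X) && (d u y < c)].
  by exists y.
move: lt_c; rewrite ltNge => /negP[]; apply: exit_dist_ge => // y yX.
by rewrite leNgt; apply: contra none => yc; apply/existsP; exists y; rewrite yX.
Qed.

Lemma exit_dist_triangle X u v : exit_dist X u <= d u v + exit_dist X v.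
Proof.
rewrite -lerBlDl; apply: exit_dist_ge => [|y yX].
  by have := exit_dist_le_bound X u; have := d_ge0 u v; lra.
by have := exit_dist_le u yX; have := d_triangle v u y; lra.
Qed.

Lemma exit_dist_lip X u v : `|exit_dist X u - exit_dist X v| <= d u v.
Proof.
rewrite ler_norml; have := exit_dist_triangle X u v.
by have := exit_dist_triangle X v u; rewrite (sym_d v); lra.
Qed.

(** A path realizing [d u v] is too short to leave [X], so the bound on [g] adds up along its
    edges. *)
Lemma lipschitz_inside (X : {set V}) (g : V -> R) u v :
  {in X &, forall x y, e x y -> `|g x - g y| <= w x y} ->
  d u v < exit_dist X u -> `|g u - g v| <= d u v.
Proof.
move=> g_lip lt_duv.
have [|p [up lp cp]] := @d_realized u v; first exact: lt_le_trans (exit_dist_le_bound X u).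
have inX q : path e u q -> path_cost w u q <= d u v -> last u q \in X.
  move=> uq cq; apply: contraLR lt_duv => lX; rewrite -leNgt.
  by apply: le_trans (exit_dist_le u lX) _; apply: le_trans (d_path uq) cq.
have {}inX p1 p2 : p = p1 ++ p2 -> last u p1 \in X.
  move=> E; move: up cp; rewrite E cat_path path_cost_cat => /andP[up1 p2P] cp.
  by apply: inX => //; have := path_cost_ge0 w_ge0 p2P; lra.
suff : `|g u - g (last u p)| <= path_cost w u p by rewrite lp => /le_trans; apply.
suff H p1 p2 : p = p1 ++ p2 -> `|g u - g (last u p1)| <= path_cost w u p1.
  by apply: (H p [::]); rewrite cats0.
elim/last_ind: p1 p2 => [|p1 x IH] p2 E; first by rewrite subrr normr0.
have E1 : p = p1 ++ x :: p2 by rewrite E cat_rcons.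
have := IH _ E1; have := inX _ _ E1; have := inX _ _ E.
rewrite last_rcons => xX lX le_p1.
rewrite -cats1 path_cost_cat /= addr0; apply: le_trans (ler_distD (g (last u p1)) _ _) _.
apply: lerD => //; apply: g_lip => //.
by move: up; rewrite E1 cat_path => /andP[_ /andP[]].
Qed.

(* The coordinate attached to the geodesics of [X] is the interval with centre
   [g] and radius [exit_dist X]; it is trivial outside [X] and changes little
   across the boundary, so it is Lipschitz on all of [V]. *)
Lemma peel_coordinate (X : {set V}) (g : V -> R) :
  {in X &, forall x y, e x y -> `|g x - g y| <= w x y} ->
  exists lam, [/\ forall S, 0 <= lam S,
    forall u v, cut_metric lam u v <= 4 * d u v &
    forall u v, Num.min (2 * `|g u - g v|) (2 * (exit_dist X u + exit_dist X v))
                <= cut_metric lam u v].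
Proof.
move=> g_lip; pose r := exit_dist X.
have [|lam [lam0 le1 le2 ge_min_]] :=
    @interval_cut_metric R V (fun u => g u - r u) (fun u => g u + r u).
  by move=> u; have := exit_dist_ge0 X u; rewrite /r; lra.
exists lam; split=> // u v; last first.
  apply: le_trans (ge_min_ u v).
  rewrite (_ : _ + _ - _ = 2 * (g u - g v)); last by lra.
  rewrite normrM ger0_norm // (_ : g u + r u - _ + _ = 2 * (r u + r v)) //.
  by rewrite /r; lra.
(* Either [g] is Lipschitz for this pair, or both radii are at most [d u v] and the two intervals
   have total length at most [4 * d u v]. *)
suff [Hg|Hr] : `|g u - g v| <= d u v \/ (r u <= d u v /\ r v <= d u v).
- apply: le_trans (le1 u v) _; have : `|r u - r v| <= d u v := exit_dist_lip X u v.
  move: Hg => Hg Hr.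
  have e1 : `|g u - r u - (g v - r v)| <= `|g u - g v| + `|r u - r v|.
    by rewrite opprD addrACA -opprD; apply: ler_normB.
  have e2 : `|g u + r u - (g v + r v)| <= `|g u - g v| + `|r u - r v|.
    by rewrite opprD addrACA; apply: ler_normD.
  lra.
- by apply: le_trans (le2 u v) _; lra.
have [lt_u|ge_u] := ltP (d u v) (r u); first by left; apply: lipschitz_inside g_lip lt_u.
have [lt_v|ge_v] := ltP (d v u) (r v); last by right; rewrite (sym_d u) in ge_u *.
by left; rewrite distrC sym_d; apply: lipschitz_inside g_lip lt_v.
Qed.

Lemma radius_coordinate (X : {set V}) :
  exists lam, [/\ forall S, 0 <= lam S,
    forall u v, cut_metric lam u v <= d u v &
    forall u v, `|exit_dist X u - exit_dist X v| <= cut_metric lam u v].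
Proof.
have [|lam [lam0 le1 _ ge_min_]] := @interval_cut_metric R V (fun=> 0) (exit_dist X).
  exact: exit_dist_ge0.
exists lam; split=> // u v.
  by apply: le_trans (le1 u v) _; rewrite subrr normr0 add0r exit_dist_lip.
apply: le_trans (ge_min_ u v); rewrite !add0r !subr0.
by rewrite le_min lexx ler_norml; have := exit_dist_ge0 X u; have := exit_dist_ge0 X v; lra.
Qed.

(** Each round costs 5 in the upper bound: 4 for the peeling coordinate and 1 for [exit_dist Y]. It
    costs a factor 16 in the lower bound: if one exit distance from [Y] is at least [M / 8] and the
    two differ by less than [M / 16], both are at least [M / 16]. *)
Lemma thin_embedding m (X : {set V}) : thin lo hi X m ->
  exists lam, [/\ forall S, 0 <= lam S,
    forall u v, cut_metric lam u v <= (5 * m)%:R * d u v &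
    forall u v, 16%:R ^- m * Num.min (d u v) (Num.min (exit_dist X u) (exit_dist X v))
                <= cut_metric lam u v].
Proof.
elim: m X => [|m IH] X thinX.
  have cut0 u v : cut_metric (fun=> 0 : R) u v = 0.
    by rewrite /cut_metric big1 // => S _; rewrite mul0r.
  exists (fun=> 0); split=> // u v; rewrite cut0 ?mul0r //.
  rewrite (_ : exit_dist X u = 0); last first.
    apply: exit_dist_out; apply/negP => uX; have := thinX (lo u).
    rewrite leqn0 cards_eq0 => /eqP/setP/(_ u); case: lohi => lohiV _.
    by rewrite !inE uX leqnn lohiV.
  by rewrite expr0 invr1 mul1r; apply: le_trans (_ : 0 <= _) => //; rewrite !ge_min lexx orbT.
have [Y [g [sYX thinY g_lip g_sep]]] :=
  peel_geodesics sym_e sym_w w_ge0 B_ge0 d_le sym_d d_path lohi thinX.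
have [lam1 [pos1 le1 ge1]] := peel_coordinate g_lip.
have [lam2 [pos2 le2 ge2]] := radius_coordinate Y.
have [lam3 [pos3 le3 ge3]] := IH Y thinY.
exists (fun S => lam1 S + lam2 S + lam3 S); split=> [S|u v|u v].
- by rewrite !addr_ge0.
- rewrite !cut_metricD mulnS natrD mulrDl; have := le1 u v; have := le2 u v; have := le3 u v.
  lra.
rewrite !cut_metricD; set M := Num.min _ _; set c : R := 16%:R ^- m.
have -> : 16%:R ^- m.+1 = c / 16 by rewrite exprS invfM mulrC.
have c_gt0 : 0 < c by rewrite invr_gt0 exprn_gt0.
have c_le1 : c <= 1 by rewrite invf_le1 ?exprn_gt0 // exprn_ege1 // ler1n.
have [M_d M_u M_v] : [/\ M <= d u v, M <= exit_dist X u & M <= exit_dist X v].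
  by rewrite /M !ge_min !lexx !orbT.
have M_ge0 : 0 <= M by rewrite !le_min d_ge0 !exit_dist_ge0.
have rho1 := cut_metric_ge0 u v pos1; have rho2 := cut_metric_ge0 u v pos2.
have rho3 := cut_metric_ge0 u v pos3.
have cM : c * M <= M by rewrite ler_piMl.
(* A vertex near the complement of [Y] but far from that of [X] is near a removed vertex, and [g]
   hardly changes on the way there. *)
have close z : z \in X -> exit_dist Y z < M / 8 -> M <= exit_dist X z ->
    exists2 z', z' \in X :\: Y & d z z' < M / 8 /\ `|g z - g z'| < M / 8.
  move=> zX lt_z M_z; have [|z' z'Y lt_z'] := @exit_dist_lt Y z (M / 8) _ lt_z.
    by have := exit_dist_le_bound X z; lra.
  have z'X : z' \in X.
    by apply: contraLR lt_z' => z'X; rewrite -leNgt; have := exit_dist_le z z'X; lra.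
  exists z'; first by rewrite in_setD z'Y.
  split=> //; apply: (le_lt_trans _ lt_z').
  by apply: (lipschitz_inside g_lip); lra.
have [eqM|M_neq0] := eqVneq M 0; first by rewrite eqM mulr0; lra.
have inX z : M <= exit_dist X z -> z \in X.
  move=> M_z; apply: contraR M_neq0 => zX; move: M_z; rewrite exit_dist_out // => M_le0.
  by rewrite eq_le M_le0.
(* If [u] or [v] is far from the geodesics removed from [X], then [Y] separates
   the two; otherwise both are close to them and [g] does. *)
have far : M / 8 <= exit_dist Y u \/ M / 8 <= exit_dist Y v ->
    c / 16 * M <= cut_metric lam1 u v + cut_metric lam2 u v + cut_metric lam3 u v.
  move=> ge_uv; have [le_sep|lt_sep] := leP (M / 16) `|exit_dist Y u - exit_dist Y v|.
    by have := ge2 u v; lra.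
  have [eu ev] : M / 16 <= exit_dist Y u /\ M / 16 <= exit_dist Y v.
    by move: lt_sep; rewrite ltr_norml => /andP[]; case: ge_uv; lra.
  have : c * (M / 16) <= cut_metric lam3 u v.
    by apply: le_trans (ge3 u v); rewrite ler_pM2l // !le_min eu ev !andbT; lra.
  lra.
have [lt_u|ge_u] := ltP (exit_dist Y u) (M / 8); last by apply: far; left.
have [lt_v|ge_v] := ltP (exit_dist Y v) (M / 8); last by apply: far; right.
have [u' u'P [duu' guu']] := close u (inX u M_u) lt_u M_u.
have [v' v'P [dvv' gvv']] := close v (inX v M_v) lt_v M_v.
(* Passing to [u'] and [v'] costs at most [M / 4] in [d] and [M / 4] in [g], so [g] separates [u]
   and [v] by at least [M / 2]. *)
suff : M <= cut_metric lam1 u v by lra.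
apply: le_trans (ge1 u v); rewrite le_min; apply/andP; split; last by lra.
have := g_sep u' v' u'P v'P; have := d_triangle u' u v; have := d_triangle v' u' v.
rewrite (sym_d v' v); have := ler_distD (g u) (g u') (g v'); have := ler_distD (g v) (g u) (g v').
rewrite (distrC (g u') (g u)); lra.
Qed.

End ThinEmbedding.

(** * Embedding shortest-path distances of possibly disconnected graphs *)

Section CappedDistance.
Variables (R : realFieldType) (V : finType) (e : rel V) (w : V -> V -> R).
Hypotheses (sym_e : symmetric e) (sym_w : forall x y, w x y = w y x).
Hypothesis w_ge0 : forall x y, e x y -> 0 <= w x y.
Variable B : R.

(* The value [B] between different components makes the embedding meaningful for
   disconnected graphs, where flows may live. *)
Definition capped_distance (d : V -> V -> R) : Prop :=
  [/\ forall u v, d u v <= B,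
      forall u v, ~~ connect e u v -> d u v = B &
      forall u v, connect e u v -> exists p,
        [/\ geodesic w e u p, last u p = v & d u v = path_cost w u p]].

Lemma path_cost_rev u p : path e u p ->
  exists q, [/\ path e (last u p) q, last (last u p) q = u &
                path_cost w (last u p) q = path_cost w u p].
Proof.
elim: p u => [|v p IH] u /=; first by exists [::].
move=> /andP[uv /IH[q [vq lq cq]]]; exists (rcons q u).
rewrite rcons_path vq lq last_rcons sym_e uv -cats1 path_cost_cat cq lq /= addr0 sym_w.
by split=> //; rewrite addrC.
Qed.

Variable d : V -> V -> R.
Hypothesis dP : capped_distance d.

Lemma capped_distance_path u p : path e u p -> d u (last u p) <= path_cost w u p.
Proof.
have [_ _ d_conn] := dP => up.
have [|q [[_ minq] lq ->]] := d_conn u (last u p); first by apply/connectP; exists p.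
by apply: minq.
Qed.

Lemma capped_distance_refl u : d u u = 0.
Proof.
have [_ _ d_conn] := dP; have [p [[up minp] lp ->]] := d_conn u u (connect0 _ _).
apply/eqP; rewrite eq_le (path_cost_ge0 w_ge0 up) andbT.
by apply: (minp [::]).
Qed.

Lemma capped_distance_sym u v : d u v = d v u.
Proof.
have [_ d_nconn d_conn] := dP; have sym_c : connect_sym e by apply: sym_connect_sym.
wlog suff le_d : u v / d u v <= d v u.
  by apply/eqP; rewrite eq_le !le_d.
have [vu|nvu] := boolP (connect e v u); last by rewrite !d_nconn // sym_c.
have [p [[vp _] <- ->]] := d_conn v u vu.
have [q [uq lq <-]] := path_cost_rev vp.
by rewrite -{2}lq; apply: capped_distance_path.
Qed.

Lemma capped_distance_ge0 u v : 0 <= d u v.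
Proof.
have [d_le d_nconn d_conn] := dP.
have [uv|nuv] := boolP (connect e u v).
  by have [p [[up _] _ ->]] := d_conn u v uv; apply: path_cost_ge0 up.
by rewrite d_nconn // -(capped_distance_refl u) d_le.
Qed.

Lemma capped_distance_triangle v u x : d u x <= d u v + d v x.
Proof.
have [d_le d_nconn d_conn] := dP.
have [uv|nuv] := boolP (connect e u v); last first.
  by rewrite (d_nconn u v nuv); have := d_le u x; have := capped_distance_ge0 v x; lra.
have [vx|nvx] := boolP (connect e v x); last first.
  by rewrite (d_nconn v x nvx); have := d_le u x; have := capped_distance_ge0 u v; lra.
have [p [[up _] lp ->]] := d_conn u v uv; have [q [[vq _] lq ->]] := d_conn v x vx.
rewrite -lq -lp in vq *; rewrite -last_cat -path_cost_cat.
by apply: capped_distance_path; rewrite cat_path up.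
Qed.

(** For the full vertex set all exit distances are [B], so the minimum in [thin_embedding] is
    [d u v]; rescaling by [16 ^ m] makes the map non-contracting. The successor keeps the constant
    at least 1. *)
Lemma capped_distance_embedding lo hi m :
  interval_rep e lo hi -> thin lo hi [set: V] m ->
  exists2 lam, (forall S, 0 <= lam S) & forall u v,
    d u v <= cut_metric lam u v <= (5 * m * 16 ^ m).+1%:R * d u v.
Proof.
move=> lohi thinV; have [d_le d_nconn d_conn] := dP.
have B_ge0 (u : V) : 0 <= B by rewrite -(capped_distance_refl u).
have [E0|[v0 _]] := set_0Vmem [set: V].
  exists (fun=> 0) => // u; have := in_setT u; by rewrite E0 inE.
have [|lam [lam0 le_lam ge_lam]] := thin_embedding sym_e sym_w w_ge0 (B_ge0 v0) d_le
  capped_distance_refl capped_distance_sym capped_distance_triangle capped_distance_path _ lohi thinV.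
  move=> u v lt_dB; have [uv|nuv] := boolP (connect e u v); last by rewrite d_nconn ?ltxx in lt_dB.
  by have [p [[up _] lp ->]] := d_conn u v uv; exists p.
exists (fun S => 16 ^+ m * lam S) => [S|u v]; first by rewrite mulr_ge0 // exprn_ge0.
have scaleE : cut_metric (fun S => 16 ^+ m * lam S) u v = 16 ^+ m * cut_metric lam u v.
  by rewrite /cut_metric mulr_sumr; apply: eq_bigr => S _; rewrite mulrA.
have pow_gt0 : 0 < 16 ^+ m :> R by rewrite exprn_gt0.
rewrite scaleE; apply/andP; split.
  rewrite -ler_pdivrMl //; apply: le_trans (ge_lam u v); rewrite ler_pM2l ?invr_gt0 //.
  by rewrite !le_min lexx !exit_dist_ge // => y; rewrite inE.
rewrite -[(5 * m * 16 ^ m).+1%:R]natr1 mulrDl mul1r; apply: ler_wpDr; first exact: capped_distance_ge0.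
by rewrite natrM natrX [(5 * m)%:R * _]mulrC -mulrA ler_pM2l.
Qed.

End CappedDistance.

(** [B0] bounds all distances within components; [B] stays free above it so that it can later
    dominate other quantities. *)
Lemma capped_distance_exists (R : realFieldType) (V : finType) (e : rel V) (w : V -> V -> R) :
  (forall x y, e x y -> 0 <= w x y) ->
  exists B0, forall B, B0 <= B -> exists d, capped_distance e w B d.
Proof.
move=> w_ge0; have [P PP] := geodesic_family w_ge0.
pose D u v := path_cost w u (P u v).
exists (\sum_u \sum_v `|D u v|) => B le_B.
exists (fun u v => if connect e u v then D u v else B); split=> [u v|u v /negbTE->//|u v uv].
  case: ifP => // _; apply: le_trans le_B; rewrite (bigD1 u) //= (bigD1 v) //=.
  rewrite -addrA; apply: le_trans (ler_norm _) _; rewrite lerDl addr_ge0 //.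
    by apply: sumr_ge0.
  by apply: sumr_ge0 => ? _; apply: sumr_ge0.
by have [gP lP] := PP u v uv; exists (P u v); rewrite uv.
Qed.

Require Import Defs.
From mathcomp Require Import all_classical all_reals all_analysis measurable_realfun.
Import Order.TTheory GRing.Theory Num.Theory.
Local Open Scope ring_scope.

(** * Flows and cuts *)

(** Split the unit interval into [N] pieces of length [1 / N], one for each vertex set [S]; on its
    piece, [f v] is [N * lam S] or 0 according to whether [v] lies in [S]. *)
Lemma cut_metric_L1 (R : realType) (V : finType) (lam : {set V} -> R) :
  (forall S, 0 <= lam S) ->
  exists2 f : V -> R -> R,
    forall v, lebesgue_measure.-integrable `[0%R, 1%R]%classic (EFin \o f v) &
    forall u v, L1_dist (f u) (f v) = (cut_metric lam u v)%:E.
Proof.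
move=> lam0; pose N : R := #|{set V}|%:R.
have N_gt0 : 0 < N by rewrite ltr0n; apply/card_gt0P; exists finset.set0.
pose J (S : {set V}) : set R :=
  `[(enum_rank S)%:R / N, (enum_rank S).+1%:R / N[%classic.
have mJ S : measurable (J S) by exact: measurable_itv.
have J_sub S : (J S `<=` `[0%R, 1%R]%classic)%classic.
  move=> t; rewrite /J /= !in_itv /= => /andP[l h]; apply/andP; split.
    by apply: le_trans l; rewrite divr_ge0 // ltW.
  apply: ltW; apply: lt_le_trans h _; rewrite ler_pdivrMr // mul1r ler_nat.
  exact: ltn_ord.
have J_disj S S' t : J S t -> J S' t -> S = S'.
  rewrite /J /= !in_itv /= !ler_pdivrMr // !ltr_pdivlMr // => /andP[l h] /andP[l' h'].
  have lt1 : (enum_rank S < (enum_rank S').+1)%N by rewrite -(ltr_nat R) (le_lt_trans l h').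
  have lt2 : (enum_rank S' < (enum_rank S).+1)%N by rewrite -(ltr_nat R) (le_lt_trans l' h).
  by apply/enum_rank_inj/val_inj/eqP; rewrite eqn_leq -ltnS lt1 -ltnS lt2.
have muJ S : lebesgue_measure (J S) = (N^-1)%:E.
  rewrite /J lebesgue_measure_itv /= lte_fin ltr_pM2r ?invr_gt0 // ltr_nat leqnn.
  by rewrite -EFinB -mulrBl -natrB // subSnn mul1r.
pose c v S : R := N * lam S * (v \in S)%:R.
pose f v t := \sum_S c v S * \1_(J S) t.
exists f => [v|u v].
  rewrite (_ : EFin \o f v = fun t => (\sum_S (c v S)%:E * (\1_(J S) t)%:E)%E).
    apply: (@integrable_sum _ _ _ lebesgue_measure) => // S _.
    apply: integrableZl => //.
    apply: (@integrableS _ _ _ _ setT) => //.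
    exact: integrable_indic_itv.
  by apply/funext => t /=; rewrite -sumEFin.
rewrite /L1_dist.
pose g S : R := N * (lam S * `|(u \in S)%:R - (v \in S)%:R|).
have g_ge0 S : 0 <= g S by rewrite !mulr_ge0 // ltW.
transitivity (\int[lebesgue_measure]_(t in `[0%R, 1%R]%classic)
    (\sum_S (g S)%:E * (\1_(J S) t)%:E))%E.
  apply: eq_integral => t _; under [RHS]eq_bigr do rewrite -EFinM; rewrite sumEFin; congr _%:E.
  have [/existsP[S0 /asboolP JS0]|none] := boolP [exists S, `[< J S t >]]; last first.
    have J0 S : \1_(J S) t = 0 :> R.
      rewrite indicE; case: (boolP (t \in J S)) => // /set_mem JS.
      by case/existsP: none; exists S; apply/asboolP.
    by rewrite /f !big1 ?subrr ?normr0 // => S _; rewrite J0 mulr0.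
  have J0 S : S != S0 -> \1_(J S) t = 0 :> R.
    move=> nS; rewrite indicE; case: (boolP (t \in J S)) => // /set_mem JS.
    by rewrite (J_disj _ _ _ JS JS0) eqxx in nS.
  have J1 : \1_(J S0) t = 1 :> R by rewrite indicE mem_set.
  have sumJ (h : {set V} -> R) : \sum_S h S * \1_(J S) t = h S0.
    by rewrite (bigD1 S0) //= J1 mulr1 big1 ?addr0 // => S /J0->; rewrite mulr0.
  rewrite /f !sumJ /c /g -mulrBr normrM ger0_norm ?mulrA //.
  by rewrite mulr_ge0 // ltW.
rewrite ge0_integral_sum //; first last.
- by move=> S t _; rewrite mule_ge0 ?lee_fin.
- by move=> S; apply: measurable_funeM; apply/measurable_EFinP; apply: measurable_indic; exact: mJ.
rewrite -sumEFin; apply: eq_bigr => S _.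
rewrite ge0_integralZl_EFin //; last by apply/measurable_EFinP; apply: measurable_indic; exact: mJ.
rewrite integral_indic; [rewrite (setIidl (@J_sub S))|exact: measurable_itv|exact: mJ].
transitivity ((g S)%:E * (N^-1)%:E)%E; first by congr (_ * _)%E; exact: muJ.
by rewrite /g -EFinM mulrAC mulfV ?gt_eqF // mul1r.
Qed.

Lemma sum_eq_op (R : pzRingType) (T : finType) (a : T) (F : T -> R) :
  \sum_x (x == a)%:R * F x = F a.
Proof.
by rewrite (bigD1 a) //= eqxx mul1r big1 ?addr0 // => x /negbTE->; rewrite mul0r.
Qed.

(** * Linear programming duality for flows *)

Section FlowDuality.
Variables (R : realType) (G : sgraph) (cap : {set G} -> R) (dem : G -> G -> R) (eps : R).

Let arc : finType := (G * G)%type.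
Let variable : finType := (arc * arc)%type.
(** In this order: nonnegativity, conservation as two opposite inequalities, and capacities. All
    vertex pairs count as arcs; the coefficients of conservation and capacity vanish on
    non-edges. *)
Let constraint : finType := (variable + arc * G + arc * G + arc)%type.

Let net (xy : arc) (a : G) : R := (xy.1 == a)%:R - (xy.2 == a)%:R.

Let coef (i : constraint) (j : variable) : R :=
  match i with
  | inl (inl (inl j')) => - (j == j')%:R
  | inl (inl (inr (st, a))) => (j.1 == st)%:R * ((adj j.2.1 j.2.2)%:R * net j.2 a)
  | inl (inr (st, a)) => - ((j.1 == st)%:R * ((adj j.2.1 j.2.2)%:R * net j.2 a))
  | inr ab => (adj ab.1 ab.2)%:R * ((j.2 == ab)%:R + (j.2 == (ab.2, ab.1))%:R)
  end.

Let rhs (i : constraint) : R :=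
  match i with
  | inl (inl (inl _)) => 0
  | inl (inl (inr (st, a))) => eps * dem st.1 st.2 * ((a == st.1)%:R - (a == st.2)%:R)
  | inl (inr (st, a)) => - (eps * dem st.1 st.2 * ((a == st.1)%:R - (a == st.2)%:R))
  | inr ab => (adj ab.1 ab.2)%:R * cap [set ab.1; ab.2]%SET
  end.

Let sum_arc (F : arc -> R) : \sum_xy F xy = \sum_x \sum_y F (x, y).
Proof. by rewrite pair_bigA; apply: eq_bigr => -[]. Qed.

Let row_net st a (X : variable -> R) :
  \sum_j (j.1 == st)%:R * ((adj j.2.1 j.2.2)%:R * net j.2 a) * X j =
  \sum_b (adj a b)%:R * X (st, (a, b)) - \sum_b (adj b a)%:R * X (st, (b, a)).
Proof.
transitivity (\sum_st' (st' == st)%:R *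
    \sum_xy (adj xy.1 xy.2)%:R * net xy a * X (st', xy)).
  under [RHS]eq_bigr do rewrite mulr_sumr.
  rewrite pair_bigA; apply: eq_bigr => -[st' xy] _ /=; by rewrite !mulrA.
rewrite sum_eq_op sum_arc.
transitivity (\sum_x \sum_y ((x == a)%:R * ((adj x y)%:R * X (st, (x, y))) -
    (y == a)%:R * ((adj x y)%:R * X (st, (x, y))))).
  by do 2!apply: eq_bigr => ? _; rewrite /net /=; lra.
under eq_bigr do rewrite sumrB.
rewrite sumrB; congr (_ - _); first by under eq_bigr do rewrite -mulr_sumr; rewrite sum_eq_op.
by under eq_bigr do rewrite sum_eq_op.
Qed.

Let row_cap a b (X : variable -> R) :
  \sum_j (adj a b)%:R * ((j.2 == (a, b))%:R + (j.2 == (b, a))%:R) * X j =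
  (adj a b)%:R * \sum_st (X (st, (a, b)) + X (st, (b, a))).
Proof.
rewrite mulr_sumr.
transitivity (\sum_st \sum_xy (adj a b)%:R * ((xy == (a, b))%:R + (xy == (b, a))%:R) * X (st, xy)).
  by rewrite pair_bigA; apply: eq_bigr => -[].
apply: eq_bigr => st _; rewrite mulrDr -(sum_eq_op (a, b) (fun xy => X (st, xy))).
rewrite -(sum_eq_op (b, a) (fun xy => X (st, xy))) !mulr_sumr -big_split.
by apply: eq_bigr => xy _ /=; lra.
Qed.

(* The dual variables: [z] for the capacity constraints, [p] for the
   conservation constraints. *)
Lemma flow_duality : ~ routable cap dem eps ->
  exists (z : G -> G -> R) (p : G -> G -> G -> R),
    [/\ forall a b, 0 <= z a b,
        forall s t x y, adj x y -> p s t y - p s t x <= z x y + z y x &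
        \sum_a \sum_(b | adj a b) z a b * cap [set a; b]%SET <
          eps * \sum_s \sum_t dem s t * (p s t t - p s t s)].
Proof.
move=> nroutable.
have [[X XP]|[y [y_ge0 y_col y_rhs]]] := farkas coef rhs.
  case: nroutable; exists (fun s t a b => (adj a b)%:R * X ((s, t), (a, b))); split.
  - move=> s t a b; rewrite mulr_ge0 //; have := XP (inl (inl (inl ((s, t), (a, b))))).
    rewrite /= (eq_bigr (fun j => - ((j == ((s, t), (a, b)))%:R * X j))) => [|j _]; last by rewrite mulNr.
    by rewrite sumrN sum_eq_op oppr_le0.
  - by move=> s t a b /negbTE->; rewrite mul0r.
  - move=> s t a; have := XP (inl (inl (inr ((s, t), a)))); rewrite /= row_net => le1.
    have := XP (inl (inr ((s, t), a))).
    rewrite /= (eq_bigr (fun j => - ((j.1 == (s, t))%:R * ((adj j.2.1 j.2.2)%:R * net j.2 a) * X j))).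
      by rewrite sumrN row_net => le2; lra.
    by move=> j _; rewrite mulNr.
  - move=> a b ab; have := XP (inr (a, b)); rewrite /= row_cap /= ab !mul1r sum_arc.
    apply: le_trans; rewrite le_eqVlt; apply/orP; left; apply/eqP.
    by do 2!apply: eq_bigr => ? _; rewrite (adj_sym b) ab !mul1r.
(* The multipliers of the two opposite inequalities combine into a potential of arbitrary sign. *)
pose p st a := y (inl (inl (inr (st, a)))) - y (inl (inr (st, a))).
have split_sum (F : constraint -> R) : \sum_i F i =
    \sum_j F (inl (inl (inl j))) + \sum_k (F (inl (inl (inr k))) + F (inl (inr k))) +
    \sum_ab F (inr ab).
  by rewrite !big_sumType big_split /= addrA.
exists (fun a b => y (inr (a, b))), (fun s t => p (s, t)); split.
- by move=> a b.
(* The column of the flow variable on this arc gives an equation whose slack is the multiplier of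
   its nonnegativity constraint. *)
- move=> s t x x' xx'; have := y_col ((s, t), (x, x')).
  rewrite split_sum /=.
  rewrite (eq_bigr (fun j => - ((j == ((s, t), (x, x')))%:R * y (inl (inl (inl j)))))); last first.
    by move=> j _; rewrite mulrN eq_sym mulrC.
  rewrite sumrN sum_eq_op.
  have -> : \sum_(k : arc * G) (y (inl (inl (inr k))) * (let (st, a) := k in
      ((s, t) == st)%:R * ((adj x x')%:R * net (x, x') a)) +
      y (inl (inr k)) * (let (st, a) := k in
      - (((s, t) == st)%:R * ((adj x x')%:R * net (x, x') a)))) =
      p (s, t) x - p (s, t) x'.
    transitivity (\sum_st (st == (s, t))%:R * \sum_a net (x, x') a * p st a).
      under [RHS]eq_bigr do rewrite mulr_sumr.
      rewrite pair_bigA; apply: eq_bigr => -[st a] _ /=.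
      by rewrite /p xx' mul1r (eq_sym st); lra.
    rewrite sum_eq_op.
    rewrite -(sum_eq_op x (p (s, t))) -(sum_eq_op x' (p (s, t))) -sumrB.
    by apply: eq_bigr => a _; rewrite /net /= mulrBl (eq_sym x) (eq_sym x').
  rewrite (eq_bigr (fun ab => (ab == (x, x'))%:R * ((adj ab.1 ab.2)%:R * y (inr ab)) +
      (ab == (x', x))%:R * ((adj ab.1 ab.2)%:R * y (inr ab)))); last first.
    move=> [a b] _ /=; rewrite (eq_sym (x, x')) !xpair_eqE (eq_sym x b) (eq_sym x' a) (andbC (b == x)).
    by lra.
  rewrite big_split /= !sum_eq_op /= [adj x' x]adj_sym xx' !mul1r.
  by have := y_ge0 (inl (inl (inl ((s, t), (x, x'))))); lra.
move: y_rhs; rewrite split_sum /= big1 => [|j _]; last by rewrite mulr0.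
rewrite add0r.
have -> : \sum_ab y (inr ab) * ((adj ab.1 ab.2)%:R * cap [set ab.1; ab.2]%SET) =
    \sum_a \sum_(b | adj a b) y (inr (a, b)) * cap [set a; b]%SET.
  rewrite sum_arc; apply: eq_bigr => a _; rewrite [RHS]big_mkcond; apply: eq_bigr => b _ /=.
  by case: (adj a b); rewrite ?mul1r ?mul0r ?mulr0.
set S1 := (X in X + _ < 0 -> _).
suff -> : S1 = - (eps * \sum_s \sum_t dem s t * (p (s, t) t - p (s, t) s)) by lra.
rewrite /S1 -(sum_arc (fun st => dem st.1 st.2 * (p st st.2 - p st st.1))) mulr_sumr -sumrN.
transitivity (\sum_st \sum_a eps * dem st.1 st.2 *
  ((a == st.1)%:R * p st a - (a == st.2)%:R * p st a)).
  by rewrite pair_bigA; apply: eq_bigr => -[st a] _ /=; rewrite /p; lra.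
apply: eq_bigr => st _; rewrite -mulr_sumr sumrB !sum_eq_op; lra.
Qed.

End FlowDuality.

(** * Bounds for graphs with small bags *)

Definition thin_graph (G : sgraph) (m : nat) : Prop :=
  exists lo hi : G -> nat, interval_rep adj lo hi /\ thin lo hi [set: G]%SET m.

(** Each vertex gets the interval from its first to its last bag; it belongs to all bags in between
    by the third condition on path decompositions. *)
Lemma pathwidth_thin (G : sgraph) k : (pathwidth G <= k)%N -> thin_graph G k.+1.
Proof.
rewrite /pathwidth; case: ex_minnP => w /asboolP[n [X [[cover edges conv] Xw]]] _ le_k.
have size_X i : (#|X i| <= k.+1)%N.
  have le_max : (#|X i| <= \max_i #|X i|)%N := leq_bigmax i.
  by move: Xw; rewrite /width; lia.
have /fin_all_exists[l /fin_all_exists[h lhP]] : forall v, exists l, exists h : 'I_n.+1,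
    [/\ v \in X l, v \in X h & forall i, v \in X i -> (l <= i <= h)%N].
  move=> v; have [i0 i0P] := cover v.
  case: (@arg_minnP _ i0 [pred i | v \in X i] val i0P) => l lP lmin.
  case: (@arg_maxnP _ i0 [pred i | v \in X i] val i0P) => h hP hmax.
  by exists l, h; split=> // i iP; apply/andP; split; [apply: lmin | apply: hmax].
exists (fun v => val (l v)), (fun v => val (h v)); split; first split.
- by move=> v; have [lP hP /(_ _ hP)/andP[]] := lhP v.
- move=> u v /edges[i /andP[uX vX]].
  have [_ _ /(_ _ uX)/andP[li _]] := lhP u; have [_ _ /(_ _ vX)/andP[_ ih]] := lhP v.
  exact: leq_trans li ih.
- move=> t; have [lt_t|le_t] := ltnP t n.+1.
    apply: leq_trans (size_X (Ordinal lt_t)); apply/subset_leq_card/fintype.subsetP => v.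
    rewrite inE => /andP[_ lth]; have [lP hP _] := lhP v.
    by apply: (fintype.subsetP (conv (l v) (Ordinal lt_t) (h v) lth)); rewrite inE lP hP.
  rewrite (_ : [set v in _ | _]%SET = finset.set0) ?cards0 //.
  apply/finset.setP => v; rewrite !inE /=; apply/negbTE; rewrite negb_and -ltnNge.
  by apply/orP; right; rewrite -ltnNge; apply: leq_trans le_t; apply: ltn_ord.
Qed.

Lemma excluded_tree_thin (F : sgraph -> Prop) (T : sgraph) :
  minor_closed F -> is_tree T -> ~ F T -> forall G, F G -> thin_graph G #|T|.+1.
Proof.
move=> closedF [_ connT acyT] nFT G FG.
apply: (admissible_intervals (@adj_sym G)).
apply: (admissible_excluded_tree (@adj_sym G) (@adj_sym T) (@adj_irrefl T) connT acyT) => -[X [X0 Xc Xd Xa]].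
by apply: nFT; apply: closedF FG _; exists X; split.
Qed.

Section Bounds.
Variables (R : realType) (G : sgraph) (m : nat).
Hypothesis thinG : thin_graph G m.

Let C : R := (5 * m * 16 ^ m).+1%:R.

Lemma walk_length_path_cost (len : {set G} -> R) u p :
  walk_length len u p = path_cost (fun x y => len [set x; y]%SET) u p.
Proof.
by rewrite /walk_length; elim: p u => [|v p IH] u /=; rewrite ?big_nil // big_cons IH.
Qed.

Lemma c1_metric_thin (d : G -> G -> R) : supported_on d -> (c1_metric d <= C%:E)%E.
Proof.
move=> [len len_ge0 dE]; pose w (x y : G) := len [set x; y]%SET.
have sym_w x y : w x y = w y x by rewrite /w finset.setUC.
(* The infimum over no walks is infinite, so a finite-valued metric forces the graph to be
   connected. *)
have conn (u v : G) : connect adj u v.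
  apply: contraT => nuv; have := dE u v; rewrite /sp_dist.
  rewrite (_ : [set _ | _ in _]%classic = classical_sets.set0) ?ereal_inf0 //.
  apply/seteqP; split=> // _ /= [p [up lp] _].
  by case/negP: nuv; apply/connectP; exists p.
have dP : capped_distance adj w (\sum_u \sum_v `|d u v|) d.
  split=> [u v|u v|u v _]; last 1 first.
  - have [p [gp lp]] := geodesic_exists len_ge0 (conn u v).
    exists p; split=> //; apply/EFin_inj; rewrite dE; apply/eqP; rewrite eq_le.
    apply/andP; split.
      apply: ereal_inf_lbound; exists p; last by rewrite walk_length_path_cost.
      by split=> //; case: gp.
    apply: le_ereal_inf_tmp => _ /= [q [uq lq] <-]; rewrite lee_fin walk_length_path_cost.
    by case: gp => _; apply; rewrite // lp.
  - rewrite (bigD1 u) //= (bigD1 v) //= -addrA; apply: le_trans (ler_norm _) _.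
    rewrite lerDl addr_ge0 // sumr_ge0 // => ? _; exact: sumr_ge0.
  - by rewrite conn.
have [lo [hi [lohi thinV]]] := thinG.
have [lam lam0 lamP] := capped_distance_embedding (@adj_sym G) sym_w len_ge0 dP lohi thinV.
have [f f_int fE] := cut_metric_L1 lam0.
apply: ereal_inf_lbound; exists C => //; split; first by rewrite ler1n.
exists f => // u v; rewrite fE !lee_fin; exact: lamP.
Qed.

Lemma c1_graph_thin : (c1_graph R G <= C%:E)%E.
Proof.
rewrite /c1_graph /sup_or_1; case: ifP => _; first by rewrite lee_fin ler1n.
by apply: ge_ereal_sup => _ [d dP <-]; apply: c1_metric_thin.
Qed.

Variables (cap : {set G} -> R) (dem : G -> G -> R).
Hypotheses (cap_ge0 : edge_nonneg cap) (dem_ge0 : forall u v, 0 <= dem u v).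

(** The dual solution gives edge lengths whose distance [d] dominates the potential differences. If
    every cut with demand were denser than [C * eps], summing over the cuts of the embedding of [d]
    would contradict the dual objective. *)
Lemma sparse_cut eps : 0 < eps -> ~ routable cap dem eps ->
  exists2 S, cut_dem dem S != 0 & sparsity cap dem S <= C * eps.
Proof.
move=> eps_gt0 nroutable.
have [z [p [z_ge0 pz obj]]] := flow_duality nroutable.
pose w x y := z x y + z y x.
have sym_w x y : w x y = w y x by rewrite /w addrC.
have w_ge0 x y : adj x y -> 0 <= w x y by move=> _; rewrite addr_ge0.
have [B0 B0P] := capped_distance_exists w_ge0.
(* With this choice [d s t] dominates the potential difference even when [s] and [t] lie in
   different components. *)
pose B := `|B0| + \sum_s \sum_t `|p s t t - p s t s|.
have [|d dP] := B0P B.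
  rewrite (le_trans (ler_norm B0)) // lerDl sumr_ge0 // => ? _; exact: sumr_ge0.
have pd s t : p s t t - p s t s <= d s t.
  have [d_le d_nconn d_conn] := dP.
  have [st|nst] := boolP (connect adj s t).
    have [q [[sq _] lq ->]] := d_conn s t st.
    suff H u r : path adj u r -> p s t (last u r) - p s t u <= path_cost w u r.
      by have := H s q sq; rewrite lq.
    elim: r u => [|v r IH] u /=; first by rewrite subrr.
    by move=> /andP[uv /IH]; have := pz s t u v uv; rewrite /w; lra.
  have le_sum : `|p s t t - p s t s| <= \sum_s \sum_t `|p s t t - p s t s|.
    rewrite (bigD1 s) //= (bigD1 t) //= -addrA lerDl addr_ge0 ?sumr_ge0 // => ? _.
    exact: sumr_ge0.
  rewrite d_nconn // /B; apply: le_trans (ler_norm _) _; apply: le_trans le_sum _.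
  by rewrite lerDr.
have [lo [hi [lohi thinV]]] := thinG.
have [lam lam0 lamP] := capped_distance_embedding (@adj_sym G) sym_w w_ge0 dP lohi thinV.
have dw x y : adj x y -> d x y <= w x y.
  move=> xy; have := capped_distance_path dP (u := x) (p := [:: y]).
  by rewrite /= xy addr0 => /(_ isT).
have C_gt0 : 0 < C by rewrite ltr0n.
have cut_dem_ge0 S : 0 <= cut_dem dem S.
  by apply: sumr_ge0 => u _; apply: sumr_ge0 => v _; rewrite mulr_ge0 ?normr_ge0.
have cut_cap_ge0 S : 0 <= cut_cap cap S.
  rewrite mulr_ge0 // sumr_ge0 // => u _; apply: sumr_ge0 => v uv.
  by rewrite mulr_ge0 ?normr_ge0 // cap_ge0.
have sum_dem : \sum_S lam S * cut_dem dem S = \sum_u \sum_v dem u v * cut_metric lam u v.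
  under eq_bigr do rewrite mulr_sumr; rewrite exchange_big; apply: eq_bigr => u _ /=.
  under eq_bigr do rewrite mulr_sumr; rewrite exchange_big; apply: eq_bigr => v _ /=.
  by rewrite /cut_metric mulr_sumr; apply: eq_bigr => S _; rewrite mulrCA.
have sum_cap : \sum_S lam S * cut_cap cap S =
    2^-1 * \sum_u \sum_(v | adj u v) cap [set u; v]%SET * cut_metric lam u v.
  rewrite /cut_cap; under eq_bigr do rewrite mulrCA; rewrite -mulr_sumr; congr (_ * _).
  under eq_bigr do rewrite mulr_sumr; rewrite exchange_big; apply: eq_bigr => u _ /=.
  under eq_bigr do rewrite mulr_sumr; rewrite exchange_big; apply: eq_bigr => v _ /=.
  by rewrite /cut_metric mulr_sumr; apply: eq_bigr => S _; rewrite mulrCA.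
apply: contrapT => noS.
have dense S : C * eps * cut_dem dem S <= cut_cap cap S.
  have [->|dS] := eqVneq (cut_dem dem S) 0; first by rewrite mulr0.
  have dS_gt0 : 0 < cut_dem dem S by rewrite lt_def dS cut_dem_ge0.
  rewrite -ler_pdivlMr // leNgt; apply/negP => lt_S; apply: noS.
  by exists S => //; apply: ltW.
have le_sum : C * eps * \sum_u \sum_v dem u v * cut_metric lam u v <=
    2^-1 * \sum_u \sum_(v | adj u v) cap [set u; v]%SET * cut_metric lam u v.
  rewrite -sum_dem -sum_cap mulr_sumr; apply: ler_sum => S _.
  by rewrite mulrCA ler_wpM2l.
have le_dem : \sum_s \sum_t dem s t * (p s t t - p s t s) <=
    \sum_u \sum_v dem u v * cut_metric lam u v.
  apply: ler_sum => u _; apply: ler_sum => v _; rewrite ler_wpM2l //.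
  by apply: le_trans (pd u v) _; have /andP[] := lamP u v.
have le_cap : 2^-1 * \sum_u \sum_(v | adj u v) cap [set u; v]%SET * cut_metric lam u v <=
    C * \sum_u \sum_(v | adj u v) z u v * cap [set u; v]%SET.
  (* Every edge is counted in both directions, which turns [z] into the symmetric length [w] and
     accounts for the factor [2^-1]. *)
  have -> : C * \sum_u \sum_(v | adj u v) z u v * cap [set u; v]%SET =
      2^-1 * \sum_u \sum_(v | adj u v) cap [set u; v]%SET * (C * w u v).
    have swap : \sum_u \sum_(v | adj u v) z v u * cap [set u; v]%SET =
        \sum_u \sum_(v | adj u v) z u v * cap [set u; v]%SET.
      rewrite (exchange_big_dep predT) //=; apply: eq_bigr => v _.
      by apply: eq_big => [u|u _]; rewrite 1?adj_sym 1?finset.setUC.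
    transitivity (2^-1 * (C * (\sum_u \sum_(v | adj u v) z u v * cap [set u; v]%SET +
        \sum_u \sum_(v | adj u v) z v u * cap [set u; v]%SET))).
      by rewrite swap; lra.
    congr (_ * _); rewrite -big_split mulr_sumr; apply: eq_bigr => u _ /=.
    rewrite -big_split mulr_sumr; apply: eq_bigr => v _ /=; rewrite /w; lra.
  rewrite ler_wpM2l //; apply: ler_sum => u _; apply: ler_sum => v uv.
  rewrite ler_wpM2l ?cap_ge0 //; have /andP[_ /le_trans] := lamP u v; apply.
  by rewrite ler_pM2l // dw.
have : C * eps * \sum_s \sum_t dem s t * (p s t t - p s t s) <=
    C * \sum_u \sum_(v | adj u v) z u v * cap [set u; v]%SET.
  apply: le_trans le_cap; apply: le_trans le_sum; rewrite ler_wpM2l //.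
  by rewrite mulr_ge0 // ltW.
by rewrite -mulrA ler_pM2l // leNgt obj.
Qed.

End Bounds.

Lemma gap_graph_thin (R : realType) (G : sgraph) m : thin_graph G m ->
  (gap_graph R G <= (2 * (5 * m * 16 ^ m).+1%:R)%:E)%E.
Proof.
move=> thinG; set C := ((5 * m * 16 ^ m).+1%:R : R).
have C_ge1 : 1 <= C by rewrite ler1n.
rewrite /gap_graph /sup_or_1; case: ifP => _; first by rewrite lee_fin; lra.
apply: ge_ereal_sup => _ [cap [dem [[cap_ge0 dem_ge0 maxP] ->]]].
have [l lE] : exists l, maxflow cap dem = l%:E.
  move: maxP; case: (maxflow cap dem) => [l _| |]; first by exists l.
    by rewrite ltxx andbF.
  by rewrite ltNge leNye.
move: maxP; rewrite lE !lte_fin => /andP[l_gt0 _].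
(* Twice the maximal value is certainly not routable; this is the origin of the factor 2 in the
   bound. *)
have [S dS sS] : exists2 S, cut_dem dem S != 0 & sparsity cap dem S <= C * (2 * l).
  apply: (sparse_cut thinG cap_ge0 dem_ge0); first by lra.
  move=> rout; have : ((2 * l)%:E <= maxflow cap dem)%E.
    by apply: ereal_sup_ubound; exists (2 * l) => //; split=> //; lra.
  by rewrite lE lee_fin; lra.
rewrite inver gt_eqF // lee_pdivrMr // -EFinM.
apply: le_trans (_ : (sparsity cap dem S)%:E <= _)%E; last by rewrite lee_fin; lra.
by rewrite /sparsest_cut; apply: bigmin_le_cond.
Qed.

Theorem theorem1p2 (R : realType) :
  (forall F : sgraph -> Prop,
     minor_closed F ->
     ~ (forall T : sgraph, is_tree T -> F T) ->
     (c1_family R F < +oo)%E) /\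
  (forall F : sgraph -> Prop,
     minor_closed F ->
     (exists k : nat, forall G : sgraph, F G -> (pathwidth G <= k)%N) ->
     (gap_family R F < +oo)%E).
Proof.
split=> F closedF.
  move=> /existsNP[T /not_implyP[treeT nFT]].
  have thinF := excluded_tree_thin closedF treeT nFT.
  apply: le_lt_trans (ltry (5 * #|T|.+1 * 16 ^ #|T|.+1).+1%:R).
  by apply: ge_ereal_sup => _ [G /thinF thinG ->]; apply: c1_graph_thin.
move=> [k le_k]; apply: le_lt_trans (ltry (2 * (5 * k.+1 * 16 ^ k.+1).+1%:R)).
apply: ge_ereal_sup => _ [G /le_k/pathwidth_thin thinG ->].
exact: gap_graph_thin.
Qed.
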